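(* Let $U=\{U(t,x);t\ge 0,x>0\}$ be an It\^o random field with dynamics $$dU(t,x)=\beta(t,x)\,dt+\gamma(t,x).dW_t,\qquad U(0,x)=u(x).$$ (i) (Necessary condition.) Suppose $U$ is a progressive utility, with conjugate utility $\widetilde U$, and let $\tilde u=\widetilde U(0,\cdot)$ be the conjugate of $u$. If $U$ is a $\mathcal K^2_{loc}$-semimartingale, then the random field $Z_t(z)=U_x(t,-\tilde u_y(z))$, $z>0$, is a strictly increasing (in $z$) solution of the stochastic differential equation $$dZ_t=\mu(t,Z_t)\,dt+\sigma(t,Z_t).dW_t,\qquad Z_0=z,$$ where $\mu(t,z)=\beta_x\big(t,-\widetilde U_y(t,z)\big)$, $\mu(t,0)=0$, and $\sigma(t,z)=\gamma_x\big(t,-\widetilde U_y(t,z)\big)$, $\sigma(t,0)=0$. (ii) (Characterization as primitive of an SDE.) Conversely, consider a stochastic differential equation with random coefficients $$dZ_t=\hat\mu(t,Z_t)\,dt+\hat\sigma(t,Z_t).dW_t,\qquad Z_0=z,$$ and assume the existence of a strong solution $Z_\cdot(z)$ which is increasing and differentiable in $z$ with range $(0,\infty)$. Then, for any utility function $u$ such that $x\mapsto Z_\cdot(u_x(x))$ is integrable in a neighborhood of $x=0$, the primitive $$U(t,x)=\int_0^xZ_t(u_x(z))\,dz,\qquad t\ge0,\ x>0,$$ is a progressive utility.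
   Context: Setting: $(\Omega,\mathbb F=(\mathcal F_t)_{t\ge0},\mathbb P)$ is a filtered probability space with right-continuous complete filtration and trivial $\mathcal F_0$, carrying an $n$-dimensional Brownian motion $W$; a dot denotes the Euclidean inner product. A progressive random field is a jointly measurable map $(t,x,\omega)\mapsto X(t,x)(\omega)$, $t\ge 0$, $x>0$, such that $X(\cdot,x)$ is progressive for each $x$. It is said to have a property in $x$ (concave, increasing, $C^m$, ...) if, outside a single null set, for every $t\ge0$ the map $x\mapsto X(t,x)(\omega)$ has the property. Subscripts $x,y,z$ denote spatial derivatives. An It\^o random field with local characteristics $(\beta,\gamma)$ is $F(t,x)=F(0,x)+B^F(t,x)+M^F(t,x)$ with $B^F(t,x)=\int_0^t\beta(s,x)ds$, $M^F(t,x)=\int_0^t\gamma(s,x).dW_s$, where $\beta,\gamma$ are progressive random fields with values in $\mathbb R$ and $\mathbb R^n$. A random field $X$ is of class $\mathcal K^m_{loc}$ (resp. $\overline{\mathcal K}^m_{loc}$) if it is $C^m$ in $x$ and, for every compact $K\subset(0,\infty)$ and $T>0$, almost surely $\int_0^T\sup_{x\in K}\|f(t,x)\|^kdt<\infty$ with $k=1$ (resp. $k=2$) for $f=X/x$ and for $f=\partial_x^jX$, $j\le m$. An It\^o random field $F$ is a $\mathcal K^m_{loc}$-semimartingale if $B^F$ is of class $\mathcal K^m_{loc}$ and $M^F$ is of class $\overline{\mathcal K}^m_{loc}$. A progressive utility is a continuous progressive random field $U$ on $(0,\infty)$ which is non-negative, strictly increasing and strictly concave in $x$, is $C^2$ in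 $x$ with continuous derivative random fields $U_x,U_{xx}$, and satisfies the Inada conditions: $U(t,x)\to0$ and $U_x(t,x)\to\infty$ as $x\to0$, $U_x(t,x)\to0$ as $x\to\infty$. A (deterministic) utility function $u$ is a deterministic function on $(0,\infty)$ with the same properties. The conjugate utility is $\widetilde U(t,y)=\sup_{x>0}(U(t,x)-xy)$, $y>0$; one has $-\widetilde U_y(t,\cdot)=U_x(t,\cdot)^{-1}$.
   Formalization: In (i), β is also assumed of class K^1_loc and γ of class K̄^1_loc (without this β_x, γ_x may not exist or give U_x); in (ii), Z_z is assumed jointly continuous in (t,z), and integrability near 0 is of the supremum of Z_t(u_x(x)) over t in [0,T]. *)

(* Defs.v *)
From HB Require Import structures.
From mathcomp Require Import all_boot all_order all_algebra.
From mathcomp Require Import all_classical all_reals all_analysis.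

Set Implicit Arguments.
Unset Strict Implicit.
Unset Printing Implicit Defensive.

Import Order.TTheory GRing.Theory Num.Theory.
Import numFieldNormedType.Exports.

Local Open Scope classical_set_scope.
Local Open Scope ring_scope.

Section deterministic.
Context {R : realType}.

(* Domains of the time and space variables; random fields are total functions
   whose values off these domains are irrelevant. *)
Definition times : set R := `[0, +oo[.
Definition positives : set R := `]0, +oo[.

Implicit Types f u : R -> R.

Definition Cm (m : nat) f : Prop :=
  (forall j, (j < m)%N -> forall x : R, 0 < x -> derivable (derive1n j f) x 1) /\
  (forall x : R, 0 < x -> {for x, continuous (derive1n m f)}).

Definition strictly_increasing f : Prop :=
  {in `]0, +oo[ &, {homo f : x y / x < y}}.

Definition strictly_concave f : Prop :=
  forall x y l, 0 < x -> 0 < y -> x != y -> 0 < l < 1 ->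
    l * f x + (1 - l) * f y < f (l * x + (1 - l) * y).

Record utility_function u : Prop := {
  utility_ge0 : forall x : R, 0 < x -> 0 <= u x;
  utility_increasing : strictly_increasing u;
  utility_concave : strictly_concave u;
  utility_C2 : Cm 2 u;
  utility_inada0 : u x @[x --> 0^'+] --> 0;
  utility_inada_d0 : derive1 u x @[x --> 0^'+] --> +oo;
  utility_inada_doo : derive1 u x @[x --> +oo] --> 0
}.

(* For a utility function the Inada condition at +oo makes the supremum
   finite, so the real-valued [sup] is the actual supremum. *)
Definition conjugate u (y : R) : R := sup [set u x - x * y | x in positives].

Definition enorm n (v : 'I_n -> R) : R := Num.sqrt (\sum_i v i ^+ 2).

End deterministic.

Section stochastic.
Context {R : realType} {d : measure_display} {Omega : measurableType d}.
Variable P : probability Omega R.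
Variable F : R -> set (set Omega).
Notation leb := (@lebesgue_measure R).

Record usual_filtration : Prop := {
  filtration_sigma : forall t : R, 0 <= t -> sigma_algebra [set: Omega] (F t);
  filtration_sub : forall t : R, 0 <= t -> F t `<=` measurable;
  filtration_mono : forall s t : R, 0 <= s -> s <= t -> F s `<=` F t;
  filtration_right : forall t : R, 0 <= t -> \bigcap_(s in `]t, +oo[) F s `<=` F t;
  filtration_complete : forall A, P.-negligible A -> F 0 A;
  filtration_trivial : forall A, F 0 A -> P A = 0%E \/ P A = 1%E
}.

Definition adapted (X : R -> Omega -> R) : Prop :=
  forall t : R, 0 <= t ->
    measurable_fun setT (X t : g_sigma_algebraType (F t) -> R).

Definition progressive (X : R -> Omega -> R) : Prop :=
  forall t : R, 0 <= t ->
    measurable_fun (`[0, t] `*` setT)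
      (fun p : R * g_sigma_algebraType (F t) => X p.1 p.2).

(* Composite and derivative processes, such as t |-> mu(t, Z_t), are only
   determined up to a null set. *)
Definition as_progressive (X : R -> Omega -> R) : Prop :=
  exists2 Y, progressive Y &
    {ae P, forall w, forall t : R, 0 <= t -> X t w = Y t w}.

Definition as_continuous (X : R -> Omega -> R) : Prop :=
  {ae P, forall w, {within times, continuous (X ^~ w)}}.

(* The coordinates of W t - W s are, given F s, i.i.d. N(0, t - s); the second
   parameter of [normal_prob] is the standard deviation. *)
Record brownian n (W : 'I_n -> R -> Omega -> R) : Prop := {
  brownian_adapted : forall i, adapted (W i);
  brownian_continuous : forall i, as_continuous (W i);
  brownian0 : {ae P, forall w, forall i, W i 0 w = 0};
  brownian_increments : forall s t : R, 0 <= s -> s < t ->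
    forall (A : set Omega) (B : 'I_n -> set R), F s A ->
      (forall i, measurable (B i)) ->
      P (A `&` [set w | forall i, B i (W i t w - W i s w)]) =
      (P A * \prod_i normal_prob 0 (Num.sqrt (t - s)) (B i))%E
}.

Section ito.
Variables (n : nat) (W : 'I_n -> R -> Omega -> R).

(* The process sum_(k < size) coef_k 1_(grid_k, grid_(k+1)]. *)
Record simple_process := SimpleProcess {
  sp_size : nat;
  sp_grid : nat -> R;
  sp_coef : 'I_n -> nat -> Omega -> R;
  sp_grid0 : 0 <= sp_grid 0%N;
  sp_grid_mono : {homo sp_grid : j k / (j <= k)%N >-> j <= k};
  sp_coef_meas : forall i k, measurable_fun setT
    (sp_coef i k : g_sigma_algebraType (F (sp_grid k)) -> R);
  sp_coef_bounded : forall i k, exists C : R, forall w, `|sp_coef i k w| <= C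
}.

Definition sp_value (H : simple_process) (i : 'I_n) (t : R) (w : Omega) : R :=
  \sum_(k < sp_size H)
    sp_coef H i k w * (sp_grid H k < t <= sp_grid H k.+1)%R%:R.

Definition sp_integral (H : simple_process) (t : R) (w : Omega) : R :=
  \sum_i \sum_(k < sp_size H) sp_coef H i k w *
    (W i (Num.min t (sp_grid H k.+1)) w - W i (Num.min t (sp_grid H k)) w).

(* Stated with the outer measure of P, to avoid measurability conditions
   on Y. *)
Definition cvg0_in_probability (Y : nat -> Omega -> \bar R) : Prop :=
  forall e r : R, 0 < e -> 0 < r ->
    \forall k \near \oo, exists A, [/\ measurable A, (P A <= r%:E)%E &
      [set w | (e%:E < Y k w)%E] `<=` A].

(* M is (a continuous version of) the stochastic integral, from 0 to t, of
   H . dW: the limit, uniformly on compacts in probability, of the integrals of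
   simple processes converging to H in L^2([0, T]) in probability. It is unique
   up to indistinguishability. *)
Record ito_integral (H : 'I_n -> R -> Omega -> R) (M : R -> Omega -> R)
    : Prop := {
  ito_progressive : forall i, as_progressive (H i);
  ito_L2 : {ae P, forall w, forall T : R, 0 < T ->
    (\int[leb]_(t in `[0%R, T]) (\sum_i H i t w ^+ 2)%:E < +oo)%E};
  ito_adapted : adapted M;
  ito_continuous : as_continuous M;
  ito_approx : exists S : nat -> simple_process, forall T : R, 0 < T ->
    cvg0_in_probability (fun k w =>
      \int[leb]_(t in `[0%R, T])
        (\sum_i (sp_value (S k) i t w - H i t w) ^+ 2)%:E)%E /\
    cvg0_in_probability (fun k w =>
      ereal_sup [set `|sp_integral (S k) t w - M t w|%:E | t in `[0%R, T]])
}.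

Definition time_integral (b : R -> Omega -> R) (t : R) (w : Omega) : R :=
  (\int[leb]_(s in `[0, t]) b s w)%R.

Definition as_time_integrable (b : R -> Omega -> R) : Prop :=
  {ae P, forall w, forall T : R, 0 < T -> leb.-integrable `[0, T] (EFin \o b ^~ w)}.

Definition Dx (j : nat) (X : R -> R -> Omega -> R) (t x : R) (w : Omega) : R :=
  derive1n j (fun x' => X t x' w) x.

Record progressive_field (X : R -> R -> Omega -> R) : Prop := {
  field_measurable :
    measurable_fun (times `*` positives `*` setT)
      (fun p : R * R * Omega => X p.1.1 p.1.2 p.2);
  field_progressive : forall x : R, 0 < x -> progressive (X ^~ x)
}.

(* Joint continuity in (t, x), outside a single null set. *)
Definition continuous_field (X : R -> R -> Omega -> R) : Prop :=
  {ae P, forall w, {within times `*` positives,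
    continuous (fun p : R * R => X p.1 p.2 w)}}.

Definition spatially (Q : (R -> R) -> Prop) (X : R -> R -> Omega -> R) : Prop :=
  {ae P, forall w, forall t : R, 0 <= t -> Q (fun x => X t x w)}.

Record progressive_utility (U : R -> R -> Omega -> R) : Prop := {
  putility_field : progressive_field U;
  putility_utility : spatially utility_function U;
  putility_continuous : forall j, (j <= 2)%N -> continuous_field (Dx j U)
}.

(* BF and MF are the finite variation and local martingale parts of X; since
   stochastic integrals are only defined up to a null set for each x, the random
   field MF is the version for which X = X(0, .) + BF + MF identically. *)
Definition BF (b : R -> R -> Omega -> R) (t x : R) (w : Omega) : R :=
  time_integral (b ^~ x) t w.

Definition MF (X b : R -> R -> Omega -> R) (t x : R) (w : Omega) : R :=
  X t x w - X 0 x w - BF b t x w.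

Record ito_field (b : R -> R -> Omega -> R) (c : 'I_n -> R -> R -> Omega -> R)
    (X : R -> R -> Omega -> R) : Prop := {
  ito_field_drift : progressive_field b;
  ito_field_diffusion : forall i, progressive_field (c i);
  ito_field_integrable : forall x : R, 0 < x -> as_time_integrable (b ^~ x);
  ito_field_integral : forall x : R, 0 < x ->
    ito_integral (fun i => c i ^~ x) (MF X b ^~ x)
}.

(* z |-> Z . z is a strong solution, for the given F and W, of
   dZ = mu(t, Z) dt + sigma(t, Z) . dW, Z 0 = z, for every z > 0. *)
Record sde_solution (mu : R -> R -> Omega -> R)
    (sigma : 'I_n -> R -> R -> Omega -> R) (Z : R -> R -> Omega -> R)
    : Prop := {
  sde_adapted : forall z : R, 0 < z -> adapted (Z ^~ z);
  sde_continuous : forall z : R, 0 < z -> as_continuous (Z ^~ z);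
  sde_init : forall z : R, 0 < z -> {ae P, forall w, Z 0 z w = z};
  sde_drift : forall z : R, 0 < z ->
    as_progressive (fun t w => mu t (Z t z w) w);
  sde_drift_int : forall z : R, 0 < z ->
    as_time_integrable (fun t w => mu t (Z t z w) w);
  sde_integral : forall z : R, 0 < z ->
    ito_integral (fun i t w => sigma i t (Z t z w) w)
      (fun t w => Z t z w - z - time_integral (fun s v => mu s (Z s z v) v) t w)
}.

End ito.

(* A real-valued field is the case n = 1. *)
Definition loc_sup_integrable (k n : nat) (f : 'I_n -> R -> R -> Omega -> R)
    : Prop :=
  forall K : set R, compact K -> K `<=` positives -> forall T : R, 0 < T ->
    {ae P, forall w, (\int[leb]_(t in `[0%R, T])
      ereal_sup [set (enorm (fun i => f i t x w) ^+ k)%:E | x in K] < +oo)%E}.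

Definition class_loc (k m n : nat) (X : 'I_n -> R -> R -> Omega -> R) : Prop :=
  [/\ forall i, spatially (Cm m) (X i),
      loc_sup_integrable k (fun i t x w => X i t x w / x) &
      forall j, (j <= m)%N -> loc_sup_integrable k (fun i => Dx j (X i))].

Definition Kloc m n (X : 'I_n -> R -> R -> Omega -> R) := class_loc 1 m X.
Definition Kbarloc m n (X : 'I_n -> R -> R -> Omega -> R) := class_loc 2 m X.

(* These conditions bear on BF and MF; they do not by themselves make the local
   characteristics differentiable in x. *)
Definition Kloc_semimartingale (m : nat) (b X : R -> R -> Omega -> R) : Prop :=
  Kloc m (fun _ : 'I_1 => BF b) /\ Kbarloc m (fun _ : 'I_1 => MF X b).

(* -U~_y(t, z) *)
Definition inv_marginal (U : R -> R -> Omega -> R) (t z : R) (w : Omega) : R :=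
  - derive1 (conjugate (fun x => U t x w)) z.

(* The field h_x(t, -U~_y(t, z)), extended by 0 at z = 0. *)
Definition sde_coef (U h : R -> R -> Omega -> R) (t z : R) (w : Omega) : R :=
  if z == 0 then 0 else Dx 1 h t (inv_marginal U t z w) w.

(* x |-> Z_.(u_x(x)), as a function with values in the continuous paths with the
   topology of uniform convergence on compact time intervals, is integrable
   near 0. *)
Definition path_integrable_near0 (u : R -> R) (Z : R -> R -> Omega -> R) : Prop :=
  {ae P, forall w, forall T : R, 0 < T -> exists2 e : R, 0 < e &
    (\int[leb]_(x in `]0%R, e[)
      ereal_sup [set `|Z t (derive1 u x) w|%:E | t in `[0%R, T]] < +oo)%E}.

Definition primitive (u : R -> R) (Z : R -> R -> Omega -> R)
    (t x : R) (w : Omega) : R :=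
  (\int[leb]_(z in `]0, x[) Z t (derive1 u z) w)%R.

End stochastic.

(* Main.v *)
Require Import Defs.
From HB Require Import structures.
From mathcomp Require Import all_boot all_order all_algebra.
From mathcomp Require Import all_classical all_reals all_analysis.
From mathcomp Require Import measurable_realfun ring lra.

Import Order.TTheory GRing.Theory Num.Theory.
Import numFieldNormedType.Exports.

Local Open Scope classical_set_scope.
Local Open Scope ring_scope.

Set Implicit Arguments.
Unset Strict Implicit.
Unset Printing Implicit Defensive.

(** The theorem rests on two exchanges: of the derivative in the space variable with
    the stochastic integral for the first part, and of limits with an ordinary
    integral, path by path, for the second.

    Necessary condition. Fix [z > 0] and let [x = - u~'(z)], so that [u'(x) = z]. By
    convex duality, [- U~_y(t, U_x(t, x)) = x] for all [t] ([derive1_conjugate]), and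
    hence the coefficients of the equation, evaluated at [Z_t = U_x(t, x)], are
    [beta_x(t, x)] and [gamma_x(t, x)]. It remains to prove
    [U_x(t, x) = U_x(0, x) + \int_0^t beta_x(s, x) ds + \int_0^t gamma_x(s, x) . dW_s],
    which is [ito_field_derive]. The difference quotient of [U] with step [1 / (m + 1)]
    is an Ito process whose integrand is the difference quotient of [gamma], because
    stochastic integrals are linear ([ito_integral_lin]: two simple processes are
    refined to a common grid). As [m] grows, the quotients of [gamma] and [beta]
    converge in [L^2] and in [L^1] in time, by the mean value theorem and dominated
    convergence, the dominating function being the supremum over a compact interval
    that the classes [Kbarloc] and [Kloc] make integrable; the quotients of [U] converge
    uniformly on compact time intervals because [U_x] is jointly continuous. Stochastic
    integrals are closed under such limits ([ito_integral_lim]): each quotient is a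
    limit of integrals of simple processes, and a diagonal sequence of these converges
    to the derivative. As the convergence is almost sure, no isometry or maximal
    inequality enters; the filtration being complete, limits off a null set stay
    adapted and progressive. Monotonicity of [Z] in [z] is that of [u'] and [U_x].

    Characterization. Let [f(t, x) = Z_t(u'(x))], a positive and strictly decreasing
    function of [x]. Being monotone and continuous in [z], and continuous in [t] for
    rational [z], the solution [Z] is jointly continuous
    ([monotone_joint_continuity]), and so is [f]. For [t <= T] and [x] in a bounded
    interval, [f] is dominated by an integrable function of [x], namely its supremum
    over [t <= T] near 0 and a constant elsewhere. So [U] is jointly continuous and
    [U_x = f], [U_xx = Z_z(t, u'(x)) u''(x)]; strict concavity and the Inada conditions
    are monotonicity and range of [Z] and of [u'] ([primitive_utility]). Measurability
    of the primitive is Tonelli's theorem, for the product with [F t] as well: off a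
    null set, [Z] is determined by its values at rational points, and the null set has
    all its subsets in the filtration ([field_jointly_progressive]). *)

(** * Utility functions and their conjugates *)

Section calculus.
Context {R : realType}.
Implicit Types f g : R -> R.

Lemma derive1_dist f x : derivable f x 1 -> forall e, 0 < e ->
  exists2 d, 0 < d & forall h, h != 0 -> `|h| < d ->
    `|derive1 f x - h^-1 * (f (h + x) - f x)| < e.
Proof.
move=> df e e0.
have cf : h^-1 *: (f (h + x) - f x) @[h --> 0^'] --> derive1 f x.
  rewrite derive1E /derive.
  suff -> : (fun h => h^-1 *: (f (h + x) - f x)) =
            (fun h => h^-1 *: ((f \o shift x) (h *: (1 : R)) - f x)) by exact: df.
  by apply/funext => h /=; rewrite /GRing.scale/= mulr1.
move/cvgrPdist_lt : cf => /(_ e e0) [d /= d0 dP].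
exists d => // h h0 hd; apply: dP => //=.
by rewrite /ball_/= sub0r normrN.
Qed.

Lemma dist_derive1 f x l : (forall e, 0 < e ->
  exists2 d, 0 < d & forall h, h != 0 -> `|h| < d ->
    `|l - h^-1 * (f (h + x) - f x)| < e) -> derivable f x 1 /\ derive1 f x = l.
Proof.
move=> H.
have cf : h^-1 *: (f (h + x) - f x) @[h --> 0^'] --> l.
  apply/cvgrPdist_lt => e e0; have [d d0 dP] := H e e0.
  exists d => //= h; rewrite /ball_/= sub0r normrN => hd h0; exact: dP.
split; last exact: cvg_lim.
apply/cvg_ex; exists l => /=.
suff <- : (fun h => h^-1 *: (f (h + x) - f x)) =
            (fun h => h^-1 *: ((f \o shift x) (h *: (1 : R)) - f x)) by [].
by apply/funext => h /=; rewrite /GRing.scale/= mulr1.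
Qed.

Lemma near_positive (x : R) : 0 < x -> \forall y \near x, 0 < y.
Proof. exact: lt_nbhsr. Qed.

Lemma eq_pos_derivable f g x : (forall y, 0 < y -> f y = g y) -> 0 < x ->
  derivable f x 1 -> derivable g x 1.
Proof.
move=> fg x0; apply: near_eq_derivable.
by near=> y; apply: fg; near: y; exact: near_positive.
Unshelve. all: by end_near. Qed.

Lemma eq_pos_derive1 f g x : (forall y, 0 < y -> f y = g y) -> 0 < x ->
  derive1 f x = derive1 g x.
Proof.
move=> fg x0; rewrite !derive1E; apply: near_eq_derive.
by near=> y; apply: fg; near: y; exact: near_positive.
Unshelve. all: by end_near. Qed.

Lemma derivable_continuous f x : derivable f x 1 -> {for x, continuous f}.
Proof. by move=> /derivable1_diffP/differentiable_continuous. Qed.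

Lemma itvcc_pos (a b x : R) : 0 < a -> x \in `[a, b]%R -> 0 < x.
Proof. by move=> a0; rewrite in_itv/= => /andP[ax _]; exact: lt_le_trans ax. Qed.

Lemma within_pos_continuous f (a b : R) : 0 < a ->
  (forall x, 0 < x -> {for x, continuous f}) -> {within `[a, b], continuous f}.
Proof.
move=> a0 cf; apply: continuous_in_subspaceT => x /set_mem xab.
by apply: cf; exact: itvcc_pos a0 xab.
Qed.

Lemma MVT_pos f (a b : R) : 0 < a -> a < b ->
  (forall x, 0 < x -> derivable f x 1) ->
  exists2 c, a < c < b & f b - f a = derive1 f c * (b - a).
Proof.
move=> a0 ab df.
have dc x : x \in `]a, b[%R -> is_derive x 1 f (derive1 f x).
  move=> xab; rewrite derive1E; apply: derivableP; apply: df.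
  by apply: (itvcc_pos a0) (subset_itv_oo_cc xab).
have cf : {within `[a, b], continuous f}.
  by apply: within_pos_continuous => // x x0; exact/derivable_continuous/df.
have [c cab ->] := MVT ab dc cf.
by exists c => //; move: cab; rewrite in_itv.
Qed.

End calculus.

Section utility.
Context {R : realType}.
Variable u : R -> R.
Hypothesis hu : utility_function u.

Lemma utility_derivable x : 0 < x -> derivable u x 1.
Proof. by have [/(_ 0%N isT) h _] := utility_C2 hu; exact: h. Qed.

Lemma utility_derivable2 x : 0 < x -> derivable (derive1 u) x 1.
Proof. by have [/(_ 1%N isT) h _] := utility_C2 hu; exact: h. Qed.

(** By concavity, a fraction [l] of the way from [x] to [y] increases [u] by at least
    [l * (u y - u x)]; divided by [l], this increase tends to [u' x * (y - x)]. *)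
Lemma utility_concave_tangent x y : 0 < x -> 0 < y ->
  u y <= u x + derive1 u x * (y - x).
Proof.
move=> x0 y0; have [->|yx] := eqVneq y x; first by rewrite subrr mulr0 addr0.
rewrite leNgt; apply/negP => gap.
have yx0 : 0 < `|y - x| by rewrite normr_gt0 subr_eq0.
set e := (u y - u x - derive1 u x * (y - x)) / `|y - x|.
have e0 : 0 < e by apply: divr_gt0 => //; lra.
have [d d0 dP] := derive1_dist (utility_derivable x0) e0.
(* [l] keeps the point [l * (y - x) + x] within [d] of [x] and inside the segment. *)
pose l := Num.min 2^-1 (d / 2 / `|y - x|).
have l0 : 0 < l by rewrite lt_min invr_gt0 ltr0n/= !divr_gt0.
have l1 : 0 < l < 1.
  by rewrite l0/= (@le_lt_trans _ _ 2^-1) ?ge_min ?lexx//; lra.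
have h0 : l * (y - x) != 0 by rewrite mulf_eq0 negb_or gt_eqF//= subr_eq0.
have hd : `|l * (y - x)| < d.
  rewrite normrM (gtr0_norm l0) (@le_lt_trans _ _ (d / 2))//; last lra.
  by rewrite -ler_pdivlMr// ge_min lexx orbT.
have := dP _ h0 hd.
set q := _^-1 * _ => qe.
have xy : l * y + (1 - l) * x = l * (y - x) + x by ring.
have := utility_concave hu y0 x0 yx l1.
rewrite xy => conc.
have qE : u (l * (y - x) + x) - u x = q * (l * (y - x)).
  by rewrite /q mulrAC mulVf// mul1r.
have : (derive1 u x - q) * (y - x) < - (e * `|y - x|).
  rewrite /e divfK ?gt_eqF// -subr_lt0 -(pmulr_rlt0 _ l0).
  set A := u (_ + _) in conc qE; nra.
move=> H; have : e * `|y - x| < `|derive1 u x - q| * `|y - x|.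
  rewrite -normrM; apply: (@lt_le_trans _ _ (- ((derive1 u x - q) * (y - x)))).
    by rewrite ltrNr.
  by rewrite -normrN ler_norm.
by rewrite ltr_pM2r// ltNge (ltW qe).
Qed.

Lemma utility_concave_tangent_lt x y : 0 < x -> 0 < y -> x != y ->
  u y < u x + derive1 u x * (y - x).
Proof.
move=> x0 y0 xy.
have m0 : 0 < 2^-1 * x + (1 - 2^-1) * y by lra.
have l : 0 < (2^-1 : R) < 1 by lra.
have := utility_concave_tangent x0 m0.
have := utility_concave hu x0 y0 xy l.
by lra.
Qed.

Lemma utility_derive1_lt x y : 0 < x -> x < y -> derive1 u y < derive1 u x.
Proof.
move=> x0 xy; have y0 : 0 < y by exact: lt_trans xy.
have := utility_concave_tangent_lt x0 y0; rewrite lt_eqF// => /(_ isT) h1.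
have := utility_concave_tangent_lt y0 x0; rewrite gt_eqF// => /(_ isT) h2.
rewrite -subr_lt0 -(pmulr_llt0 _ (_ : 0 < y - x)); last by rewrite subr_gt0.
nra.
Qed.

Lemma utility_derive1_gt0 x : 0 < x -> 0 < derive1 u x.
Proof.
move=> x0; have x1 : 0 < x + 1 by lra.
have := utility_concave_tangent_lt x0 x1; rewrite lt_eqF ?ltrDl// => /(_ isT).
have := utility_increasing hu; move=> /(_ x (x + 1)).
rewrite !in_itv/= !andbT => /(_ x0 x1); rewrite ltrDl => /(_ ltr01); lra.
Qed.

Lemma utility_derive1_continuous x : 0 < x -> {for x, continuous (derive1 u)}.
Proof. by move=> x0; exact/derivable_continuous/utility_derivable2. Qed.

Lemma utility_derive1_surj z : 0 < z -> exists2 x, 0 < x & derive1 u x = z.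
Proof.
move=> z0.
have [a a0 za] : exists2 a, 0 < a & z < derive1 u a.
  have := utility_inada_d0 hu => /cvgryPgt/(_ z) H.
  have : \forall x \near 0^'+, 0 < x /\ z < derive1 u x.
    by near=> x; split; near: x; [exact: nbhs_right_gt|exact: H].
  by move=> /filter_ex[x [? ?]]; exists x.
have [b ab bz] : exists2 b, a < b & derive1 u b < z.
  have := utility_inada_doo hu => /cvgrPdist_lt/(_ z z0) H.
  have : \forall x \near +oo, a < x /\ derive1 u x < z.
    near=> x; split; first by near: x; apply: nbhs_pinfty_gt; exact: num_real.
    have : `|0 - derive1 u x| < z by near: x; exact: H.
    by rewrite sub0r normrN; exact: le_lt_trans (ler_norm _).
  by move=> /filter_ex[x [? ?]]; exists x.
have cu : {within `[a, b], continuous (derive1 u)}.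
  by apply: within_pos_continuous => // x; exact: utility_derive1_continuous.
have zab : Num.min (derive1 u a) (derive1 u b) <= z <= Num.max (derive1 u a) (derive1 u b).
  by rewrite ge_min le_max (ltW za) (ltW bz) orbT.
have [c cab <-] := IVT (ltW ab) cu zab.
by exists c => //; exact: itvcc_pos cab.
Unshelve. all: by end_near. Qed.

Lemma conjugate_derive1 x : 0 < x -> conjugate u (derive1 u x) = u x - x * derive1 u x.
Proof.
move=> x0; rewrite /conjugate; set A := [set _ | _ in _].
have Ax : A (u x - x * derive1 u x) by exists x => //; rewrite /positives/= in_itv/= x0.
have ubA : ubound A (u x - x * derive1 u x).
  move=> _ [y + <-]; rewrite /positives/= in_itv/= andbT => y0.
  by have := utility_concave_tangent x0 y0; lra.
apply/eqP; rewrite eq_le; apply/andP; split; first by apply: ge_sup => //; exists (u x - x * derive1 u x).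
by apply: sup_upper_bound => //; split; [exists (u x - x * derive1 u x)|exists (u x - x * derive1 u x)].
Qed.

(** By the two tangent inequalities, the difference quotient of the conjugate
    between [u' x] and [u' v] lies between [- x] and [- v]; and [v] is close to
    [x] as soon as [u' v] is close to [u' x], because [u'] is monotone. *)
Lemma derive1_conjugate x : 0 < x -> derive1 (conjugate u) (derive1 u x) = - x.
Proof.
move=> x0; apply: (proj2 (dist_derive1 _)) => e e0.
(* [r < x] keeps the points [x - r] and [x + r] in the domain of [u]. *)
pose r := Num.min (e / 2) (x / 2).
have r0 : 0 < r by rewrite lt_min !divr_gt0.
have re : r < e by rewrite (@le_lt_trans _ _ (e / 2)) ?ge_min ?lexx//; lra.
have rx : r < x by rewrite (@le_lt_trans _ _ (x / 2)) ?ge_min ?lexx ?orbT//; lra.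
pose d := Num.min (derive1 u (x - r) - derive1 u x) (derive1 u x - derive1 u (x + r)).
have d0 : 0 < d.
  by rewrite lt_min !subr_gt0 !utility_derive1_lt//; lra.
exists d => // h h0 hd.
have h1 : h < derive1 u (x - r) - derive1 u x.
  rewrite (le_lt_trans (ler_norm h))// (lt_le_trans hd)//.
  by rewrite ge_min lexx.
have h2 : - h < derive1 u x - derive1 u (x + r).
  rewrite (@le_lt_trans _ _ `|h|)//; first by rewrite -normrN ler_norm.
  by rewrite (lt_le_trans hd)// ge_min lexx orbT.
have ux : 0 < derive1 u (x + r) by apply: utility_derive1_gt0; lra.
have [v v0 vE] := @utility_derive1_surj (h + derive1 u x) ltac:(lra).
have vx1 : x - r < v.
  rewrite ltNge le_eqVlt; apply/negP => /predU1P[vE'|vr]; first by rewrite vE' in vE; lra.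
  by have := utility_derive1_lt v0 vr; lra.
have vx2 : v < x + r.
  rewrite ltNge le_eqVlt; apply/negP => /predU1P[vE'|vr]; first by rewrite -vE' in vE; lra.
  by have := @utility_derive1_lt (x + r) v ltac:(lra) vr; lra.
have vxe : `|v - x| < e by rewrite ltr_norml; lra.
rewrite -vE !conjugate_derive1// (le_lt_trans _ vxe)//.
set q := _^-1 * _.
have t1 := utility_concave_tangent x0 v0.
have t2 := utility_concave_tangent v0 x0.
have qE : u v - v * derive1 u v - (u x - x * derive1 u x) = q * h.
  by rewrite /q mulrAC mulVf// mul1r.
have hE : h = derive1 u v - derive1 u x by lra.
have [hpos|hneg|hz] := ltgtP h 0; last by rewrite hz eqxx in h0.
- have vx : x <= v.
    rewrite leNgt; apply/negP => vx; have := utility_derive1_lt v0 vx; lra.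
  rewrite [`|v - x|]ger0_norm ?subr_ge0// ler_norml; apply/andP; split; nra.
- have vx : v <= x.
    rewrite leNgt; apply/negP => vx; have := utility_derive1_lt x0 vx; lra.
  rewrite [`|v - x|]ler0_norm ?subr_le0// ler_norml; apply/andP; split; nra.
Qed.

End utility.

(** * Linear combinations of simple processes *)

Section refinement.
Context {R : realType}.
Implicit Types (g : nat -> R) (s : seq R) (phi : R -> R).

(** The cells selected by the indicator are those between the indices [p] and [q],
    and possibly degenerate ones, over which [phi] has no increment. *)
Lemma telescope_subgrid g N p q phi : {homo g : j k / (j <= k)%N >-> j <= k} ->
  (p <= q <= N)%N ->
  \sum_(k < N) ((g p <= g k) && (g k.+1 <= g q))%:R * (phi (g k.+1) - phi (g k)) =
  phi (g q) - phi (g p).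
Proof.
move=> gm /andP[pq qN].
rewrite -(big_mkord xpredT (fun k =>
  ((g p <= g k) && (g k.+1 <= g q))%:R * (phi (g k.+1) - phi (g k)))).
rewrite (big_cat_nat (n := p))//=; last exact: leq_trans pq qN.
rewrite (big_cat_nat (n := q) (m := p))//=.
rewrite [X in X + _](_ : _ = 0) ?add0r; last first.
  rewrite big1_seq// => k /andP[_]; rewrite mem_index_iota => /andP[_ kp].
  have [/andP[pk kq]|_] := boolP ((g p <= g k) && _); last by rewrite mul0r.
  have -> : g k = g p by apply/eqP; rewrite eq_le pk gm// ltnW.
  have -> : g k.+1 = g p by apply/eqP; rewrite eq_le (gm k.+1 p)//= (le_trans pk)// gm.
  by rewrite subrr mulr0.
rewrite [X in _ + X](_ : _ = 0) ?addr0; last first.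
  rewrite big1_seq// => k /andP[_]; rewrite mem_index_iota => /andP[qk _].
  have [/andP[pk kq]|_] := boolP ((g p <= g k) && _); last by rewrite mul0r.
  have -> : g k.+1 = g q by apply/eqP; rewrite eq_le kq gm// leqW.
  have -> : g k = g q by apply/eqP; rewrite eq_le (gm q k)// andbT (le_trans _ kq)// gm.
  by rewrite subrr mulr0.
apply: (@telescope_sumr_eq _ p q (phi \o g)) => // k /andP[pk kq] /=.
by rewrite !gm// mul1r.
Qed.

(** The grid with set of points [s], extended by its last point. *)
Definition seq_grid s k := nth 0 (sort <=%R s) (minn k (size s).-1).

Lemma seq_grid_mono s : {homo seq_grid s : j k / (j <= k)%N >-> j <= k}.
Proof.
move=> j k jk; rewrite /seq_grid; case: s => [|a s]; first by rewrite !nth_nil.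
apply: (le_sorted_leq_nth _ (sort_le_sorted _)); rewrite ?inE ?size_sort.
- by rewrite /= ltnS geq_minr.
- by rewrite /= ltnS geq_minr.
- by rewrite leq_min geq_minr andbT (leq_trans _ jk)// geq_minl.
Qed.

Lemma seq_grid_ge0 s k : (forall x, x \in s -> 0 <= x) -> 0 <= seq_grid s k.
Proof.
move=> s0; rewrite /seq_grid; case: s s0 => [|a s] s0; first by rewrite !nth_nil.
by apply: s0; rewrite -(mem_sort <=%R) mem_nth// size_sort /= ltnS geq_minr.
Qed.

Lemma seq_gridP s a b : a \in s -> b \in s -> a <= b ->
  exists pq : nat * nat, [/\ (pq.1 <= pq.2 <= (size s).-1)%N,
    seq_grid s pq.1 = a & seq_grid s pq.2 = b].
Proof.
move=> sa sb ab; set t := sort <=%R s.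
have sI x : x \in s -> (index x t <= (size s).-1)%N.
  move=> sx; have : (index x t < size s)%N.
    by rewrite -(size_sort <=%R) index_mem mem_sort.
  by case: (size s).
have gI x : x \in s -> seq_grid s (index x t) = x.
  move=> sx; rewrite /seq_grid (minn_idPl (sI _ sx)) nth_index//.
  by rewrite mem_sort.
exists (index a t, index b t) => /=; split; [|exact: gI|exact: gI].
rewrite sI// andbT leqNgt; apply/negP => ba.
have := @sorted_ltn_index _ <=%R le_trans t (sort_le_sorted _) b a.
rewrite !mem_sort => /(_ sb sa ba) ba'.
by move: ba; have -> : a = b by [apply/eqP; rewrite eq_le ab]; rewrite ltnn.
Qed.

Lemma telescope_seq_grid s a b phi : a \in s -> b \in s -> a <= b ->
  \sum_(k < (size s).-1) ((a <= seq_grid s k) && (seq_grid s k.+1 <= b))%:R *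
    (phi (seq_grid s k.+1) - phi (seq_grid s k)) = phi b - phi a.
Proof.
move=> sa sb ab; have [[p q]/= [pq <- <-]] := seq_gridP sa sb ab.
by rewrite telescope_subgrid//; exact: seq_grid_mono.
Qed.

End refinement.

Lemma filtration_measurable_fun {R : realType} {d} {Omega : measurableType d}
    (P : probability Omega R) (F : R -> set (set Omega)) (s t : R) (f : Omega -> R) :
  usual_filtration P F -> 0 <= s -> s <= t ->
  measurable_fun setT (f : g_sigma_algebraType (F s) -> R) ->
  measurable_fun setT (f : g_sigma_algebraType (F t) -> R).
Proof.
move=> hF s0 st mf mD Y mY; have := mf measurableT Y mY.
exact: (sub_sigma_algebra2 (filtration_mono hF s0 st)).
Qed.

Lemma bounded_sum {R : realType} {T : Type} (I : Type) (r : seq I) (f : I -> T -> R) :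
  (forall i, exists C : R, forall w, `|f i w| <= C) ->
  exists C : R, forall w, `|\sum_(i <- r) f i w| <= C.
Proof.
move=> fC; elim: r => [|i r [C rC]].
  by exists 0 => w; rewrite big_nil normr0.
have [D iD] := fC i; exists (D + C) => w; rewrite big_cons.
by rewrite (le_trans (ler_normD _ _))// lerD.
Qed.

Section simple_processes.
Context {R : realType} {d : measure_display} {Omega : measurableType d}.
Variables (P : probability Omega R) (F : R -> set (set Omega)).
Hypothesis hF : usual_filtration P F.
Variable n : nat.
Implicit Types H : simple_process F n.

(** The pairing of a simple process with the increments of a path [phi]: the
    values of the process and its stochastic integral are two instances of it. *)
Definition sp_pairing H (i : 'I_n) (w : Omega) (phi : R -> R) : R :=
  \sum_(k < sp_size H) sp_coef H i k w * (phi (sp_grid H k.+1) - phi (sp_grid H k)).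

Lemma sp_valueE H i t w : sp_value H i t w = sp_pairing H i w (fun r => (t <= r)%R%:R).
Proof.
apply: eq_bigr => k _; congr (_ * _).
have gm : sp_grid H k <= sp_grid H k.+1 by exact: sp_grid_mono.
have [tk|kt] := leP t (sp_grid H k); last by rewrite subr0.
by rewrite (le_trans tk gm) subrr.
Qed.

Lemma sp_integralE H W t w : sp_integral W H t w =
  \sum_i sp_pairing H i w (fun r => W i (Num.min t r) w).
Proof. by []. Qed.

Definition sp_points H : seq R := [seq sp_grid H k | k <- iota 0 (sp_size H).+1].

Lemma mem_sp_points H k : (k <= sp_size H)%N -> sp_grid H k \in sp_points H.
Proof. by move=> kH; apply: map_f; rewrite mem_iota/= add0n ltnS. Qed.

Lemma sp_grid_ge0 H k : 0 <= sp_grid H k.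
Proof. by rewrite (le_trans (sp_grid0 H))//; exact: sp_grid_mono. Qed.

Section linear.
Variables (a b : R) (H1 H2 : simple_process F n).

Let s := sp_points H1 ++ sp_points H2.
Let g := seq_grid s.

(** The coefficient of [H] on a cell of the finer grid is the one of the cell of
    [H] that contains it; it is known at the left end of the finer cell. *)
Let refined H (i : 'I_n) (k : nat) (w : Omega) : R := \sum_(j < sp_size H)
  sp_coef H i j w * ((sp_grid H j <= g k) && (g k.+1 <= sp_grid H j.+1))%:R.

Let refined_meas H i k : measurable_fun setT
  (refined H i k : g_sigma_algebraType (F (g k)) -> R).
Proof.
apply: (@measurable_sum _ (g_sigma_algebraType (F (g k)))) => j.
have [jk|kj] := leP (sp_grid H j) (g k); last first.
  rewrite (_ : (fun _ => _) = cst 0); first exact: measurable_cst.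
  by apply/funext => w; rewrite mulr0.
apply: (@measurable_funM _ (g_sigma_algebraType (F (g k)))); last exact: measurable_cst.
apply: (filtration_measurable_fun hF _ jk); first exact: sp_grid_ge0.
exact: sp_coef_meas.
Qed.

Let refined_bounded H i k : exists C : R, forall w, `|refined H i k w| <= C.
Proof.
apply: bounded_sum => j; have [C jC] := sp_coef_bounded H i j; exists C => w.
rewrite normrM; case: (_ && _); first by rewrite normr1 mulr1.
by rewrite normr0 mulr0 (le_trans _ (jC w)).
Qed.

Let refined_pairing H i w phi : {subset sp_points H <= s} ->
  \sum_(k < (size s).-1) refined H i k w * (phi (g k.+1) - phi (g k)) =
  sp_pairing H i w phi.
Proof.
move=> Hs; under eq_bigr do rewrite /refined mulr_suml.
rewrite exchange_big/=; apply: eq_bigr => j _.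
rewrite -(@telescope_seq_grid _ s (sp_grid H j) (sp_grid H j.+1) phi).
- by rewrite mulr_sumr; apply: eq_bigr => k _; rewrite mulrA.
- by apply: Hs; apply: mem_sp_points; exact: ltnW.
- by apply: Hs; exact: mem_sp_points.
- exact: sp_grid_mono.
Qed.

Let lin_ge0 : 0 <= g 0.
Proof.
apply: seq_grid_ge0 => x; rewrite mem_cat => /orP[] /mapP[k _ ->];
  exact: sp_grid_ge0.
Qed.

Let lin_meas i k : measurable_fun setT
  ((fun w => a * refined H1 i k w + b * refined H2 i k w)
    : g_sigma_algebraType (F (g k)) -> R).
Proof.
by apply: (@measurable_funD _ (g_sigma_algebraType (F (g k))));
   apply: (@measurable_funM _ (g_sigma_algebraType (F (g k)))) => //;
   exact: measurable_cst.
Qed.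

Let lin_bounded i k :
  exists C : R, forall w, `|a * refined H1 i k w + b * refined H2 i k w| <= C.
Proof.
have [C1 h1] := refined_bounded H1 i k; have [C2 h2] := refined_bounded H2 i k.
exists (`|a| * C1 + `|b| * C2) => w; rewrite (le_trans (ler_normD _ _))//.
by rewrite !normrM lerD// ler_wpM2l.
Qed.

Definition sp_lin : simple_process F n :=
  @SimpleProcess _ _ _ F n (size s).-1 g _ lin_ge0 (@seq_grid_mono _ s)
    lin_meas lin_bounded.

Lemma sp_lin_pairing i w phi :
  sp_pairing sp_lin i w phi = a * sp_pairing H1 i w phi + b * sp_pairing H2 i w phi.
Proof.
rewrite -(@refined_pairing H1); last by move=> x; rewrite mem_cat => ->.
rewrite -(@refined_pairing H2); last by move=> x; rewrite mem_cat => ->; rewrite orbT.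
rewrite !mulr_sumr -big_split/=; apply: eq_bigr => k _.
by rewrite mulrDl !mulrA.
Qed.

Lemma sp_lin_value i t w :
  sp_value sp_lin i t w = a * sp_value H1 i t w + b * sp_value H2 i t w.
Proof. by rewrite !sp_valueE sp_lin_pairing. Qed.

Lemma sp_lin_integral W t w :
  sp_integral W sp_lin t w = a * sp_integral W H1 t w + b * sp_integral W H2 t w.
Proof.
rewrite !sp_integralE !mulr_sumr -big_split/=.
by apply: eq_bigr => i _; rewrite sp_lin_pairing.
Qed.

End linear.
End simple_processes.

(** * Convergence to zero in probability *)

Section measure_theory.
Context {d : measure_display} {T : measurableType d} {R : realType}.
Variable mu : {measure set T -> \bar R}.
Local Open Scope ereal_scope.

(** The integral of a nonnegative function is the supremum over the simple
    functions below it, hence monotone even on functions that are not known to be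
    measurable, such as suprema over an uncountable set. *)
Lemma ge0_le_integral_nonmeas (D : set T) (f g : T -> \bar R) :
  (forall x, D x -> 0 <= f x) -> (forall x, D x -> f x <= g x) ->
  \int[mu]_(x in D) f x <= \int[mu]_(x in D) g x.
Proof.
move=> f0 fg.
have g0 x : D x -> 0 <= g x by move=> Dx; exact: le_trans (f0 _ Dx) (fg _ Dx).
rewrite !ge0_integralE//; apply: ereal_sup_le => _ [h hf <-]; exists h => // x.
rewrite (le_trans (hf x))// /patch; case: ifPn => // /set_mem; exact: fg.
Qed.

Lemma subset_ge0_le_integral (A B : set T) (f g : T -> \bar R) : A `<=` B ->
  (forall x, B x -> 0 <= g x) -> (forall x, A x -> 0 <= f x <= g x) ->
  \int[mu]_(x in A) f x <= \int[mu]_(x in B) g x.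
Proof.
move=> AB g0 fg; rewrite [X in X <= _]integral_mkcond [X in _ <= X]integral_mkcond.
apply: ge0_le_integral_nonmeas => x _; rewrite /patch.
  by case: ifPn => // /set_mem/fg/andP[].
case: ifPn => [/set_mem Ax|_].
  by rewrite mem_set; [case/andP: (fg _ Ax)|exact: AB].
by case: ifPn => // /set_mem/g0.
Qed.

End measure_theory.

Section in_probability.
Context {R : realType} {d : measure_display} {Omega : measurableType d}.
Variable P : probability Omega R.
Implicit Types X Y : nat -> Omega -> \bar R.

(** If [Y] is small wherever [X1] and [X2] are, the exceptional set of [Y] is
    covered by those of [X1] and [X2] and a null set. *)
Lemma cvg0_in_probability_dom2 Y X1 X2 :
  cvg0_in_probability P X1 -> cvg0_in_probability P X2 ->
  (forall e : R, 0 < e -> exists2 e' : R, 0 < e' &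
    \forall k \near \oo, {ae P, forall w, (X1 k w <= e'%:E)%E ->
      (X2 k w <= e'%:E)%E -> (Y k w <= e%:E)%E}) ->
  cvg0_in_probability P Y.
Proof.
move=> X1c X2c H e r e0 r0; have [e' e'0 e'P] := H e e0.
have r20 : 0 < r / 2 by lra.
near=> k.
have [A1 [mA1 PA1 XA1]] : exists A, [/\ measurable A, (P A <= (r / 2)%:E)%E &
      [set w | (e'%:E < X1 k w)%E] `<=` A].
  by near: k; exact: X1c.
have [A2 [mA2 PA2 XA2]] : exists A, [/\ measurable A, (P A <= (r / 2)%:E)%E &
      [set w | (e'%:E < X2 k w)%E] `<=` A].
  by near: k; exact: X2c.
have [N [mN N0 NP]] : {ae P, forall w, (X1 k w <= e'%:E)%E ->
      (X2 k w <= e'%:E)%E -> (Y k w <= e%:E)%E}.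
  by near: k.
exists (A1 `|` A2 `|` N); split.
- by do 2?[apply: measurableU].
- rewrite measureU0//; last exact: measurableU.
  rewrite (le_trans (measureU2 _ mA1 mA2))//.
  by rewrite (splitr r) EFinD leeD.
- move=> w /= Yw; have [?|X1w] := pselect (A1 w); first by left; left.
  have [?|X2w] := pselect (A2 w); first by left; right.
  right; apply: NP => /= NY.
  have X1e : (X1 k w <= e'%:E)%E by rewrite leNgt; apply/negP => h; apply: X1w; exact: XA1.
  have X2e : (X2 k w <= e'%:E)%E by rewrite leNgt; apply/negP => h; apply: X2w; exact: XA2.
  by have := NY X1e X2e; rewrite leNgt Yw.
Unshelve. all: by end_near. Qed.

(** The sets where [Y' j] exceeds [e] for some [j >= k] decrease with [k] to a null
    set, so that their probabilities tend to 0; this uses their measurability. *)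
Lemma ae_cvg0_in_probability Y Y' :
  (forall k, measurable_fun setT (Y' k)) ->
  (forall k, {ae P, forall w, Y k w = Y' k w}) ->
  {ae P, forall w, forall e : R, 0 < e -> \forall k \near \oo, (Y k w <= e%:E)%E} ->
  cvg0_in_probability P Y.
Proof.
move=> mY' YY' cY e r e0 r0.
pose B k := [set w | (e%:E < Y' k w)%E].
have mB k : measurable (B k).
  by rewrite -[B k]setTI; exact: emeasurable_fun_o_infty.
pose A k := \bigcup_(j in [set j | (k <= j)%N]) B j.
have mA k : measurable (A k) by apply: bigcup_measurable => j _.
have mAi : measurable (\bigcap_k A k) by exact: bigcap_measurable.
have A0 : P (\bigcap_k A k) = 0%E.
  apply/(@negligibleP _ _ _ P _ mAi).
  have aeY : {ae P, forall w, forall k, Y k w = Y' k w} by exact: ae_foralln.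
  apply: negligibleS (filterI cY aeY) => w Aw /= [cYw Yw].
  have [K _ KP] := cYw e e0; have [j Kj] := Aw K I.
  by rewrite /B/= -Yw ltNge KP.
have nA : nonincreasing_seq A.
  move=> k l kl; apply/subsetPset => w [j lj Bj]; exists j => //=.
  exact: leq_trans lj.
have cA : P \o A @ \oo --> 0%E.
  rewrite -A0; apply: nonincreasing_cvg_mu => //.
  by rewrite (le_lt_trans (probability_le1 _ _))// ltry.
have /fine_cvgP[_ /cvgrPdist_lt/(_ _ r0) cA'] := cA.
near=> k.
have [N [mN N0 NP]] := YY' k.
exists (A k `|` N); split; first exact: measurableU.
- rewrite measureU0//.
  have : `|0 - (fine \o (P \o A)) k| < r by near: k.
  rewrite sub0r normrN /= => /ltW h.
  by rewrite -(fineK (fin_num_measure P _ (mA k))) lee_fin (le_trans (ler_norm _)).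
- move=> w /= Yw; have [Yw'|Yw'] := pselect (Y k w = Y' k w).
    by left; exists k => //=; rewrite /B/= -Yw'.
  by right; apply: NP.
Unshelve. all: by end_near. Qed.

Lemma cvg0_in_probability_diag Y :
  (forall m, exists A, [/\ measurable A, (P A <= m.+1%:R^-1%:E)%E &
      [set w | (m.+1%:R^-1%:E < Y m w)%E] `<=` A]) ->
  cvg0_in_probability P Y.
Proof.
move=> H e r e0 r0; near=> m; have [A [mA PA YA]] := H m.
exists A; split=> //.
  rewrite (le_trans PA)// lee_fin ltW//.
  by near: m; exact: near_infty_natSinv_lt (PosNum r0).
move=> w /= Yw; apply: YA => /=; rewrite (le_lt_trans _ Yw)// lee_fin ltW//.
by near: m; exact: near_infty_natSinv_lt (PosNum e0).
Unshelve. all: by end_near. Qed.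

End in_probability.

(** * Measurability with respect to a complete filtration *)

Lemma within_continuous_dist {R : realType} {T : pseudoMetricType R}
    {V : pseudoMetricType R} (A : set T) (f : T -> V) :
  {within A, continuous f} <-> (forall x, A x -> forall e : R, 0 < e ->
    exists2 r : R, 0 < r & forall y, A y -> ball x r y -> ball (f x) e (f y)).
Proof.
split.
- move=> /subspace_continuousP cf x Ax e e0.
  have := cf x Ax => /cvg_ballP/(_ e e0).
  rewrite near_withinE => /nbhs_ballP[r /= r0 rP].
  by exists r => // y Ay xy; exact: rP.
- move=> H; apply/subspace_continuousP => x Ax; apply/cvg_ballP => e e0.
  have [r r0 rP] := H x Ax e e0.
  by rewrite near_withinE; apply/nbhs_ballP; exists r => // y xy Ay; exact: rP.
Qed.

Section filtered_space.
Context {R : realType} {d : measure_display} {Omega : measurableType d}.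
Variables (P : probability Omega R) (F : R -> set (set Omega)).
Hypothesis hF : usual_filtration P F.
Notation sigF t := (g_sigma_algebraType (F t)).

Lemma measurable_filtration (t : R) (A : set Omega) : 0 <= t ->
  measurable (A : set (sigF t)) = F t A.
Proof.
by move=> t0; rewrite (measurable_g_measurableTypeE (filtration_sigma hF t0)).
Qed.

Lemma negligible_measurable_filtration (t : R) (A : set Omega) :
  0 <= t -> P.-negligible A -> measurable (A : set (sigF t)).
Proof.
move=> t0 A0; rewrite measurable_filtration//.
by apply: (filtration_mono hF _ t0) => //; exact: (filtration_complete hF).
Qed.

Lemma measurable_to_filtration (t : R) : 0 <= t ->
  measurable_fun setT (id : Omega -> sigF t).
Proof.
move=> t0 _ A; rewrite measurable_filtration// setTI => FA.
exact: (filtration_sub hF t0).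
Qed.

(** The set where [f] and [g] differ and all its subsets belong to [F 0]. *)
Lemma ae_measurable_filtration (t : R) (f g : Omega -> R) : 0 <= t ->
  {ae P, forall w, f w = g w} -> measurable_fun setT (g : sigF t -> R) ->
  measurable_fun setT (f : sigF t -> R).
Proof.
move=> t0 fg mg _ Y mY; pose N := ~` [set w | f w = g w].
have mN A : A `<=` N -> measurable (A : set (sigF t)).
  by move=> AN; apply: negligible_measurable_filtration => //; exact: negligibleS fg.
rewrite setTI (_ : _ @^-1` _ = (g @^-1` Y `\` N) `|` (f @^-1` Y `&` N)).
  apply: (@measurableU _ (sigF t)); last by apply: mN => w [].
  apply: (@measurableD _ (sigF t)); last exact: mN.
  by rewrite -[X in measurable X]setTI; exact: mg.
apply/seteqP; split => w /=.
  have [fgw|fgw] := pselect (f w = g w); last by right; split.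
  by left; split; [rewrite -fgw|apply; exact: fgw].
move=> [[gY]|[]//]; rewrite /N/= => /contrapT ->; exact: gY.
Qed.

Lemma adapted_measurable (X : R -> Omega -> R) : adapted F X ->
  forall t : R, 0 <= t -> measurable_fun setT (X t).
Proof.
move=> aX t t0; have := aX t t0 => mX.
exact: (measurableT_comp mX (measurable_to_filtration t0)).
Qed.

Lemma adapted_lin (a b : R) (X Y : R -> Omega -> R) : adapted F X -> adapted F Y ->
  adapted F (fun t w => a * X t w + b * Y t w).
Proof.
move=> aX aY t t0.
by apply: (@measurable_funD _ (sigF t)); apply: (@measurable_funM _ (sigF t));
  [exact: measurable_cst|exact: aX|exact: measurable_cst|exact: aY].
Qed.

(** The null set of divergence is removed from the sequence, which then converges
    everywhere, and is restored in the limit by completeness. *)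
Lemma adapted_lim (X : nat -> R -> Omega -> R) (Y : R -> Omega -> R) :
  (forall m, adapted F (X m)) ->
  {ae P, forall w, forall t : R, 0 <= t -> X m t w @[m --> \oo] --> Y t w} ->
  adapted F Y.
Proof.
move=> aX XY t t0.
pose N := ~` [set w | forall t : R, 0 <= t -> X m t w @[m --> \oo] --> Y t w].
have mN : measurable (~` N : set (sigF t)).
  by apply: measurableC; exact: negligible_measurable_filtration.
apply: (@ae_measurable_filtration _ _ (fun w => \1_(~` N) w * Y t w)) => //.
  by apply: filterS XY => w Hw; rewrite indicE mem_set ?mul1r// /N setCK.
apply: (@measurable_fun_cvg _ (sigF t) _ _ (fun m w => \1_(~` N) w * X m t w)).
  move=> m; apply: (@measurable_funM _ (sigF t)); last exact: aX.
  exact: (@measurable_indic _ (sigF t)).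
move=> w _; rewrite /indic.
have [wN|wN] := boolP (w \in ~` N).
  by apply: cvgMl_tmp; move/set_mem: wN; rewrite /N setCK => /(_ t t0).
by under eq_fun do rewrite mul0r; rewrite mul0r; exact: cvg_cst.
Qed.

Lemma measurable_strip (t : R) : measurable (`[0, t] `*` setT : set (R * sigF t)).
Proof. by apply: measurableX => //; exact: measurable_itv. Qed.

Lemma progressive_lin (a b : R) (X Y : R -> Omega -> R) :
  progressive F X -> progressive F Y ->
  progressive F (fun t w => a * X t w + b * Y t w).
Proof.
move=> pX pY t t0.
by apply: measurable_funD; apply: measurable_funM;
  [exact: measurable_cst|exact: pX|exact: measurable_cst|exact: pY].
Qed.

Lemma progressive_section (X : R -> Omega -> R) : progressive F X ->
  forall t : R, 0 <= t -> forall w, measurable_fun `[0, t] (X ^~ w).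
Proof.
move=> pX t t0 w.
apply: (@measurable_comp _ _ _ _ (R * sigF t)%type _ (`[0, t] `*` setT)
  (fun p => X p.1 p.2) _ (fun s : R => (s, w : sigF t))).
- exact: measurable_strip.
- by move=> _ [s s0t <-]; split.
- exact: pX.
- by apply: measurable_funTS; apply: measurable_fun_pair => //; exact: measurable_cst.
Qed.

Lemma progressive_joint (X : R -> Omega -> R) : progressive F X ->
  forall t : R, 0 <= t ->
  measurable_fun (`[0, t] `*` setT) (fun p : R * Omega => X p.1 p.2).
Proof.
move=> pX t t0.
apply: (@measurable_comp _ _ _ _ (R * sigF t)%type _ (`[0, t] `*` setT)
  (fun p => X p.1 p.2) _ (fun p : R * Omega => (p.1, p.2 : sigF t))).
- exact: measurable_strip.
- by move=> _ [[s v] [s0t _] <-]; split.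
- exact: pX.
- apply: measurable_funTS; apply: measurable_fun_pair => //.
  exact: (measurableT_comp (measurable_to_filtration t0) measurable_snd).
Qed.

Lemma as_progressive_lin (a b : R) (X Y : R -> Omega -> R) :
  as_progressive P F X -> as_progressive P F Y ->
  as_progressive P F (fun t w => a * X t w + b * Y t w).
Proof.
move=> [X' pX' XX'] [Y' pY' YY'].
exists (fun t w => a * X' t w + b * Y' t w); first exact: progressive_lin.
by apply: filterS2 XX' YY' => w Xw Yw t t0; rewrite Xw// Yw.
Qed.

(** As for [adapted_lim]: the null set of divergence belongs to [F 0], hence the
    sequence may be cut off on it and remains progressive. *)
Lemma as_progressive_lim (X : nat -> R -> Omega -> R) (Y : R -> Omega -> R) :
  (forall m, as_progressive P F (X m)) ->
  {ae P, forall w, forall t : R, 0 <= t -> X m t w @[m --> \oo] --> Y t w} ->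
  as_progressive P F Y.
Proof.
move=> pX XY.
have /choice[X' X'P] : forall m, exists X', progressive F X' /\
    {ae P, forall w, forall t : R, 0 <= t -> X m t w = X' t w}.
  by move=> m; have [X' ? ?] := pX m; exists X'.
have X'Y : {ae P, forall w, forall t : R, 0 <= t -> X' m t w @[m --> \oo] --> Y t w}.
  have := @ae_foralln _ _ _ P (fun m w => forall t : R, 0 <= t -> X m t w = X' m t w)
    (fun m => proj2 (X'P m)).
  apply: filterS2 XY => w XYw XX'w t t0.
  by under eq_fun do rewrite -XX'w//; exact: XYw.
pose N := ~` [set w | forall t : R, 0 <= t -> X' m t w @[m --> \oo] --> Y t w].
exists (fun t w => \1_(~` N) w * Y t w); last first.
  by apply: filterS X'Y => w Hw t t0; rewrite indicE mem_set ?mul1r// /N setCK.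
move=> t t0.
have mN : measurable (~` N : set (sigF t)).
  by apply: measurableC; exact: negligible_measurable_filtration.
apply: (@measurable_fun_cvg _ (R * sigF t)%type _ _
    (fun m p => \1_(~` N) p.2 * X' m p.1 p.2)).
  move=> m; apply: measurable_funM; last exact: (proj1 (X'P m)).
  apply: measurable_funTS.
  have mI : measurable_fun setT (\1_(~` N) : sigF t -> R) by exact: measurable_indic.
  exact: (measurableT_comp mI measurable_snd).
move=> [s w] /= [+ _]; rewrite in_itv/= => /andP[s0 _].
rewrite /indic; have [wN|wN] := boolP (w \in ~` N).
  by apply: cvgMl_tmp; move/set_mem: wN; rewrite /N setCK => /(_ s s0).
by under eq_fun do rewrite mul0r; rewrite mul0r; exact: cvg_cst.
Qed.

Lemma as_progressive_section (X : R -> Omega -> R) : as_progressive P F X ->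
  {ae P, forall w, forall t : R, 0 <= t -> measurable_fun `[0, t] (X ^~ w)}.
Proof.
move=> [Y pY XY]; apply: filterS XY => w XYw t t0.
apply: (eq_measurable_fun (Y ^~ w)); last exact: progressive_section.
by move=> s /set_mem/=; rewrite in_itv/= => /andP[s0 _]; rewrite XYw.
Qed.

End filtered_space.

(** * Square norms of paths *)

Section L2.
Context {R : realType} {n : nat}.
Notation leb := (@lebesgue_measure R).
Implicit Types (f g : 'I_n -> R -> R).

Definition sqnorm f (t : R) : R := \sum_i f i t ^+ 2.

Lemma sqnorm_ge0 f t : 0 <= sqnorm f t.
Proof. by apply: sumr_ge0 => i _; exact: sqr_ge0. Qed.

Lemma measurable_sqnorm (D : set R) f :
  (forall i, measurable_fun D (f i)) -> measurable_fun D (sqnorm f).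
Proof. by move=> mf; apply: measurable_sum => i; exact: measurable_funX. Qed.

Definition L2sq (T : R) f : \bar R := (\int[leb]_(t in `[0%R, T]) (sqnorm f t)%:E)%E.

Lemma le_L2sq (S T : R) f : S <= T -> (L2sq S f <= L2sq T f)%E.
Proof.
move=> ST; apply: subset_ge0_le_integral.
- by apply: subset_itvl; rewrite bnd_simp.
- by move=> t _; rewrite lee_fin sqnorm_ge0.
- by move=> t _; rewrite lexx lee_fin sqnorm_ge0.
Qed.

(** Integrated form of [(x + y)^2 <= 2 x^2 + 2 y^2]. *)
Lemma L2sq_lin (a b T : R) f g :
  (forall i, measurable_fun `[0, T] (f i)) ->
  (forall i, measurable_fun `[0, T] (g i)) ->
  (L2sq T (fun i t => a * f i t + b * g i t)%R <=
   (2 * a ^+ 2)%:E * L2sq T f + (2 * b ^+ 2)%:E * L2sq T g)%E.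
Proof.
move=> mf mg.
have c0 (c : R) : (0 <= (2 * c ^+ 2)%:E)%E by rewrite lee_fin mulr_ge0// sqr_ge0.
have sq0 h t : (0 <= (sqnorm h t)%:E)%E by rewrite lee_fin sqnorm_ge0.
rewrite /L2sq -!ge0_integralZl//; try by apply/measurable_EFinP; exact: measurable_sqnorm.
rewrite -ge0_integralD//; last 4 first.
- by move=> t _; rewrite mule_ge0.
- by apply: measurable_funeM; apply/measurable_EFinP; exact: measurable_sqnorm.
- by move=> t _; rewrite mule_ge0.
- by apply: measurable_funeM; apply/measurable_EFinP; exact: measurable_sqnorm.
apply: ge0_le_integral_nonmeas => [t _|t _]; first exact: sq0.
rewrite -!EFinM -EFinD lee_fin /sqnorm !mulr_sumr -big_split/=.
apply: ler_sum => i _; have := sqr_ge0 (a * f i t - b * g i t).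
by rewrite -subr_ge0; congr (0 <= _); ring.
Qed.

End L2.

(** * Measurability of integrals and suprema of paths *)

Section parametric.
Context {R : realType} {d : measure_display} {T : measurableType d}.
Notation leb := (@lebesgue_measure R).

Lemma measurable_integral_param (D : set R) (f : R -> T -> \bar R) :
  measurable D -> measurable_fun (D `*` setT) (fun p : R * T => f p.1 p.2) ->
  (forall t w, D t -> (0 <= f t w)%E) ->
  measurable_fun setT (fun w => \int[leb]_(t in D) f t w)%E.
Proof.
move=> mD mf f0.
pose g := (fun p : R * T => f p.1 p.2) \_ (D `*` setT).
have mg : measurable_fun setT g.
  by apply/(measurable_restrictT _ _).1 => //; exact: measurableX.
have g0 p : (0 <= g p)%E.
  by rewrite /g /patch; case: ifPn => // /set_mem[Dp _]; exact: f0.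
have := @measurable_fun_fubini_tonelli_G _ _ _ _ R leb g mg g0.
congr (measurable_fun _ _); apply/funext => w; rewrite /fubini_G.
rewrite [RHS]integral_mkcond; apply: eq_integral => t _.
rewrite /g /patch; congr (if _ then _ else _).
by rewrite in_setX in_setT andbT.
Qed.

Lemma measurable_L2sq n (S : R) (X : 'I_n -> R -> T -> R) :
  (forall i, measurable_fun (`[0, S] `*` setT) (fun p : R * T => X i p.1 p.2)) ->
  measurable_fun setT (fun w => L2sq S (fun i t => X i t w)).
Proof.
move=> mX; apply: (@measurable_integral_param _
  (fun t w => (sqnorm (fun i t => X i t w) t)%:E)) => //.
- apply/measurable_EFinP; apply: measurable_sum => i.
  exact: measurable_funX.
- by move=> t w _; rewrite lee_fin sqnorm_ge0.
Qed.

End parametric.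

Section dense.
Context {R : realType}.

Definition rat_seq (k : nat) : R := ratr (odflt 0 (unpickle k : option rat)).

Lemma rat_seq_dense (a b : R) : a < b -> exists k, a < rat_seq k < b.
Proof.
move=> /rat_in_itvoo[q]; rewrite in_itv/= => qab.
by exists (pickle q); rewrite /rat_seq pickleK.
Qed.

Definition clamp (a b x : R) : R := Num.min b (Num.max a x).

Lemma clamp_in (a b x : R) : a <= b -> a <= clamp a b x <= b.
Proof. by move=> ab; rewrite /clamp le_min ge_min lexx ab le_max lexx. Qed.

Lemma clamp_seq_dense (a b t e : R) : a <= t <= b -> 0 < e ->
  exists k, `|t - clamp a b (rat_seq k)| < e.
Proof.
move=> /andP[at_ tb] e0; have [k /andP[h1 h2]] := @rat_seq_dense (t - e) (t + e) ltac:(lra).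
exists k; rewrite ltr_norml /clamp.
have [?|?] := leP (rat_seq k) a; have [?|?] := leP b _; lra.
Qed.

(** Continuity reduces the supremum to a countable one. Rational points are clamped
    to [[a, b]] so that the endpoints are reached as well. *)
Lemma ereal_sup_clamp (a b : R) (f : R -> R) : a <= b ->
  (forall t, a <= t <= b -> forall e : R, 0 < e -> exists2 r : R, 0 < r &
    forall s, a <= s <= b -> `|t - s| < r -> `|f t - f s| < e) ->
  ereal_sup [set (f t)%:E | t in `[a, b]] =
  esups (fun k => (f (clamp a b (rat_seq k)))%:E) 0.
Proof.
move=> ab fc; apply/eqP; rewrite eq_le; apply/andP; split; last first.
  apply: ereal_sup_le => _ [k _ <-].
  exists (clamp a b (rat_seq k)) => //=; rewrite in_itv/=; exact: clamp_in.
apply/ereal_supP => _ [t + <-]; rewrite /= in_itv/= => tab.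
apply/lee_addgt0Pr => e e0; have [r r0 rP] := fc t tab e e0.
have [k kr] := clamp_seq_dense tab r0.
have := rP _ (clamp_in _ ab) kr; rewrite ltr_norml => /andP[_ h].
apply: (@le_trans _ _ ((f (clamp a b (rat_seq k)))%:E + e%:E)%E).
  by rewrite -EFinD lee_fin; lra.
by rewrite leeD2r//; apply: ereal_sup_ubound; exists k.
Qed.

End dense.

(** * Linear combinations and limits of stochastic integrals *)

Section ito_limits.
Context {R : realType} {d : measure_display} {Omega : measurableType d}.
Variables (P : probability Omega R) (F : R -> set (set Omega)).
Hypothesis hF : usual_filtration P F.
Variables (n : nat) (W : 'I_n -> R -> Omega -> R).
Implicit Types (H : 'I_n -> R -> Omega -> R) (M : R -> Omega -> R).

Lemma ae_L2sq_measurable H (T : R) : 0 <= T -> (forall i, as_progressive P F (H i)) ->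
  exists2 Y, measurable_fun setT Y &
    {ae P, forall w, L2sq T (fun i t => H i t w) = Y w}.
Proof.
move=> T0 pH.
have /choice[H' H'P] : forall i, exists Y, progressive F Y /\
    {ae P, forall w, forall t : R, 0 <= t -> H i t w = Y t w}.
  by move=> i; have [Y ? ?] := pH i; exists Y.
exists (fun w => L2sq T (fun i t => H' i t w)).
  by apply: measurable_L2sq => i; apply: (progressive_joint hF) T0; case: (H'P i).
have : {ae P, forall w, forall i, forall t : R, 0 <= t -> H i t w = H' i t w}.
  by apply: filter_forall => i; case: (H'P i).
apply: filterS => w HH; apply: eq_integral => t /set_mem/=.
rewrite in_itv/= => /andP[t0 _]; congr (_%:E).
by apply: eq_bigr => i _; rewrite HH.
Qed.

(** A supremum over time is measurable in [w] because the paths are continuous. *)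
Lemma ae_sup_measurable M (T : R) : 0 <= T ->
  (forall t, 0 <= t -> measurable_fun setT (M t)) -> as_continuous P M ->
  exists2 Y, measurable_fun setT Y &
    {ae P, forall w, ereal_sup [set `|M t w|%:E | t in `[0%R, T]] = Y w}.
Proof.
move=> T0 mM cM.
exists (fun w => esups (fun k => `|M (clamp 0 T (rat_seq k)) w|%:E) 0).
  apply: measurable_fun_esups => k; apply/measurable_EFinP.
  apply: measurableT_comp => //; apply: mM.
  by have /andP[] := clamp_in (rat_seq k) T0.
apply: filterS cM => w /within_continuous_dist cMw.
apply: ereal_sup_clamp => // t /andP[t0 tT] e e0.
have tt : times t by rewrite /times/= in_itv/= t0.
have [r r0 rP] := cMw t tt e e0; exists r => // s /andP[s0 sT] ts.
apply: (le_lt_trans (ler_dist_dist _ _)).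
by apply: rP => //; rewrite /times/= in_itv/= s0.
Qed.

Lemma measurable_sp_value (S : simple_process F n) i w (D : set R) :
  measurable_fun D (fun t => sp_value S i t w).
Proof.
apply: measurable_sum => k; apply: measurable_funM => //.
rewrite (_ : (fun _ => _) = \1_(`]sp_grid S k, sp_grid S k.+1])).
  exact: measurable_indic.
by apply/funext => t; rewrite indicE mem_setE in_itv.
Qed.

Lemma as_continuous_lin (a b : R) (X Y : R -> Omega -> R) :
  as_continuous P X -> as_continuous P Y ->
  as_continuous P (fun t w => a * X t w + b * Y t w).
Proof.
move=> cX cY; apply: filterS2 cX cY => w cXw cYw t.
apply: cvgD; apply: cvgMl_tmp; [exact: cXw|exact: cYw].
Qed.

(** The same combination of approximating simple processes, on a common grid,
    approximates the combination. *)
Lemma ito_integral_lin (a b : R) H1 H2 M1 M2 :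
  ito_integral P F W H1 M1 -> ito_integral P F W H2 M2 ->
  ito_integral P F W (fun i t w => a * H1 i t w + b * H2 i t w)
    (fun t w => a * M1 t w + b * M2 t w).
Proof.
move=> [pH1 L1 aM1 cM1 [S1 S1P]] [pH2 L2 aM2 cM2 [S2 S2P]].
have mH H : (forall i, as_progressive P F (H i)) -> {ae P, forall w,
    forall i, forall T : R, 0 <= T -> measurable_fun `[0, T] ((H i)^~ w)}.
  by move=> pH; apply: filter_forall => i; exact: as_progressive_section.
split.
- by move=> i; exact: as_progressive_lin.
- apply: filterS2 (filterI (mH _ pH1) (mH _ pH2)) (filterI L1 L2).
  move=> w [m1 m2] [l1 l2] T T0; have T0' := ltW T0.
  apply: (le_lt_trans (L2sq_lin a b (fun i => m1 i T T0') (fun i => m2 i T T0'))).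
  by rewrite lte_add_pinfty// lte_mul_pinfty ?l1 ?l2// lee_fin mulr_ge0// sqr_ge0.
- exact: adapted_lin.
- exact: as_continuous_lin.
exists (fun k => sp_lin hF a b (S1 k) (S2 k)) => T T0.
have [S1a S1b] := S1P T T0; have [S2a S2b] := S2P T T0; split.
- apply: (cvg0_in_probability_dom2 S1a S2a) => e e0.
  set c := 2 * a ^+ 2 + 2 * b ^+ 2.
  have c0 : 0 <= c by rewrite addr_ge0// mulr_ge0// sqr_ge0.
  exists (e / (c + 1)); first by rewrite divr_gt0//; lra.
  apply: nearW => k; apply: filterS2 (mH _ pH1) (mH _ pH2) => w m1 m2 h1 h2.
  rewrite (_ : (fun t => _) = (fun t => (sqnorm (fun i t =>
      a * (sp_value (S1 k) i t w - H1 i t w) +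
      b * (sp_value (S2 k) i t w - H2 i t w)) t)%:E)); last first.
    apply/funext => t; congr (_%:E); apply: eq_bigr => i _.
    by congr (_ ^+ 2); rewrite sp_lin_value; ring.
  apply: (le_trans (L2sq_lin a b _ _)).
  + move=> i; apply: measurable_funB; first exact: measurable_sp_value.
    exact: m1 (ltW T0).
  + move=> i; apply: measurable_funB; first exact: measurable_sp_value.
    exact: m2 (ltW T0).
  + apply: (@le_trans _ _ ((2 * a ^+ 2)%:E * (e / (c + 1))%:E +
        (2 * b ^+ 2)%:E * (e / (c + 1))%:E)%E).
      by apply: leeD; apply: lee_wpmul2l => //; rewrite lee_fin mulr_ge0// sqr_ge0.
    rewrite -!EFinM -EFinD lee_fin -mulrDl -/c mulrCA ger_pMr//.
    by rewrite ler_pdivrMr ?mul1r; lra.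
- apply: (cvg0_in_probability_dom2 S1b S2b) => e e0.
  set c := `|a| + `|b|.
  have c0 : 0 <= c by rewrite addr_ge0.
  exists (e / (c + 1)); first by rewrite divr_gt0//; lra.
  apply: nearW => k; apply: nearW => w /ereal_supP h1 /ereal_supP h2.
  apply/ereal_supP => _ [t tT <-]; rewrite lee_fin.
  have {}h1 : `|sp_integral W (S1 k) t w - M1 t w| <= e / (c + 1).
    by rewrite -lee_fin; apply: h1; exists t.
  have {}h2 : `|sp_integral W (S2 k) t w - M2 t w| <= e / (c + 1).
    by rewrite -lee_fin; apply: h2; exists t.
  rewrite sp_lin_integral [X in `|X|](_ : _ =
    a * (sp_integral W (S1 k) t w - M1 t w) +
    b * (sp_integral W (S2 k) t w - M2 t w)); last by ring.
  rewrite (le_trans (ler_normD _ _))// !normrM.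
  apply: (@le_trans _ _ (c * (e / (c + 1)))).
    by rewrite /c mulrDl; apply: lerD; apply: ler_wpM2l.
  by rewrite mulrCA ger_pMr// ler_pdivrMr ?mul1r; lra.
Qed.

Lemma within_continuous_unif_lim (f : nat -> R -> R) (g : R -> R) :
  (forall m, {within times, continuous (f m)}) ->
  (forall T e : R, 0 < T -> 0 < e -> \forall m \near \oo,
    forall t, 0 <= t <= T -> `|f m t - g t| <= e) ->
  {within times, continuous g}.
Proof.
move=> cf fg; apply/within_continuous_dist => t tt e e0.
have t0 : 0 <= t by move: tt; rewrite /times/= in_itv/= andbT.
have e4 : 0 < e / 4 by lra.
have t1 : 0 < t + 1 by lra.
have [m mP] := filter_ex (fg _ _ t1 e4).
have /within_continuous_dist/(_ t tt _ e4)[r r0 rP] := cf m.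
exists (Num.min r 1) => [|s ss ts]; first by rewrite lt_min r0/=.
have s0 : 0 <= s by move: ss; rewrite /times/= in_itv/= andbT.
have tsr : ball t r s by apply: le_ball ts; rewrite ge_min lexx.
have ts1 : `|t - s| < 1 by apply: lt_le_trans ts _; rewrite ge_min lexx orbT.
have h1 : `|f m t - g t| <= e / 4 by apply: mP; lra.
have h2 : `|f m s - g s| <= e / 4 by apply: mP; move: ts1; rewrite ltr_norml; lra.
have := rP s ss tsr; rewrite /ball/= => h3.
rewrite /ball/= (_ : g t - g s = - (f m t - g t) + (f m s - g s) + (f m t - f m s)); last by ring.
rewrite (le_lt_trans (ler_normD _ _))// (le_lt_trans (lerD (ler_normD _ _) (lexx _)))//.
by rewrite normrN; lra.
Qed.

(** Each member of the sequence is the limit of integrals of simple processes, and a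
    diagonal choice of these approximates the limit. Measurability in [w] of the distances turns almost
    sure convergence into convergence in probability. *)
Lemma ito_integral_lim (H : nat -> 'I_n -> R -> Omega -> R) (M : nat -> R -> Omega -> R) H0 M0 :
  (forall m, ito_integral P F W (H m) (M m)) ->
  {ae P, forall w, forall i (t : R), 0 <= t -> H m i t w @[m --> \oo] --> H0 i t w} ->
  {ae P, forall w, forall T e : R, 0 < T -> 0 < e -> \forall m \near \oo,
    (L2sq T (fun i t => (H m i t w - H0 i t w)%R) <= e%:E)%E} ->
  {ae P, forall w, forall T e : R, 0 < T -> 0 < e -> \forall m \near \oo,
    forall t, 0 <= t <= T -> `|M m t w - M0 t w| <= e} ->
  ito_integral P F W H0 M0.
Proof.
move=> iHM cvgH cvgL2 cvgM.
have pH0 i : as_progressive P F (H0 i).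
  apply: (as_progressive_lim hF (X := fun m => H m i)).
    by move=> m; exact: ito_progressive (iHM m) i.
  by apply: filterS cvgH => w Hw t t0; exact: Hw.
have mH : {ae P, forall w, forall m i (T : R), 0 <= T ->
    measurable_fun `[0, T] ((H m i)^~ w)}.
  apply: ae_foralln => m; apply: filter_forall => i.
  by apply: as_progressive_section; exact: ito_progressive (iHM m) i.
have mH0 : {ae P, forall w, forall i (T : R), 0 <= T ->
    measurable_fun `[0, T] ((H0 i)^~ w)}.
  by apply: filter_forall => i; exact: as_progressive_section.
have cM0 : as_continuous P M0.
  have cM : {ae P, forall w, forall m, {within times, continuous ((M m)^~ w)}}.
    by apply: ae_foralln => m; exact: ito_continuous (iHM m).
  by apply: filterS2 cM cvgM => w cMw cvgMw; exact: within_continuous_unif_lim cMw cvgMw.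
have aM0 : adapted F M0.
  apply: (adapted_lim hF (X := M)) => [m|]; first exact: ito_adapted (iHM m).
  apply: filterS cvgM => w cvgMw t t0; apply/cvgrPdist_le => e e0.
  have t1 : 0 < t + 1 by lra.
  apply: filterS (cvgMw _ _ t1 e0) => m mP.
  by rewrite distrC; apply: mP; lra.
have pD m i : as_progressive P F (fun t w => H m i t w - H0 i t w).
  have := as_progressive_lin 1 (- 1) (ito_progressive (iHM m) i) (pH0 i).
  congr as_progressive; apply/funext => t; apply/funext => w; ring.
split => //.
- apply: filterS2 (filterI mH mH0) (filterI cvgL2 (ae_foralln (fun m => ito_L2 (iHM m)))).
  move=> w [m1 m2] [cL2 L2] T T0; have T0' := ltW T0.
  have [m mP] := filter_ex (cL2 T 1 T0 ltr01).
  rewrite [X in (X < _)%E](_ : _ = L2sq T (fun i t =>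
      1 * H m i t w + (- 1) * (H m i t w - H0 i t w))%R); last first.
    apply: eq_integral => t _; congr (_%:E); apply: eq_bigr => i _; congr (_ ^+ 2); ring.
  apply: (le_lt_trans (L2sq_lin _ _ _ _)).
  + by move=> i; exact: m1.
  + by move=> i; apply: measurable_funB; [exact: m1|exact: m2].
  + have c0 (c : R) : (0 <= (2 * c ^+ 2)%:E)%E by rewrite lee_fin mulr_ge0 ?sqr_ge0.
    apply: lte_add_pinfty; apply: lte_mul_pinfty => //; first exact: L2.
    exact: le_lt_trans mP (ltry _).
have /choice[S SP] : forall m, exists S : simple_process F n,
    (exists A, [/\ measurable A, (P A <= m.+1%:R^-1%:E)%E &
      [set w | (m.+1%:R^-1%:E < L2sq m.+1%:R (fun i t => (sp_value S i t w - H m i t w)%R))%E]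
        `<=` A]) /\
    (exists A, [/\ measurable A, (P A <= m.+1%:R^-1%:E)%E &
      [set w | (m.+1%:R^-1%:E < ereal_sup [set `|sp_integral W S t w - M m t w|%:E |
         t in `[0%R, m.+1%:R]])%E] `<=` A]).
  move=> m; have [S SP] := ito_approx (iHM m).
  have m0 : 0 < m.+1%:R :> R by [].
  have v0 : 0 < m.+1%:R^-1 :> R by rewrite invr_gt0.
  have [/(_ _ _ v0 v0) c1 /(_ _ _ v0 v0) c2] := SP m.+1%:R m0.
  by have [k [? ?]] := filter_ex (filterI c1 c2); exists (S k); split.
exists S => T T0; split.
- have c1 : cvg0_in_probability P
      (fun m w => L2sq T (fun i t => (sp_value (S m) i t w - H m i t w)%R)).
    have := cvg0_in_probability_diag (fun m => proj1 (SP m)).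
    move=> c; apply: (cvg0_in_probability_dom2 c c) => e e0; exists e => //.
    near=> m; apply: nearW => w h _; apply: le_trans h; apply: le_L2sq.
    by apply: ltW; apply: (@lt_trans _ _ m%:R); [near: m; exact: nbhs_infty_gtr|rewrite ltr_nat].
  have c2 : cvg0_in_probability P
      (fun m w => L2sq T (fun i t => (H m i t w - H0 i t w)%R)).
    have /choice[Y YP] : forall m, exists Y, measurable_fun setT Y /\
        {ae P, forall w, L2sq T (fun i t => (H m i t w - H0 i t w)%R) = Y w}.
      by move=> m; have [Y ? ?] := ae_L2sq_measurable (ltW T0) (pD m); exists Y.
    apply: (@ae_cvg0_in_probability _ _ _ _ _ Y).
    + by move=> m; case: (YP m).
    + by move=> m; case: (YP m).
    + by apply: filterS cvgL2 => w cw e e0; exact: cw.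
  apply: (cvg0_in_probability_dom2 c1 c2) => e e0.
  exists (e / 4); first by rewrite divr_gt0.
  apply: nearW => m; apply: filterS2 mH mH0 => w m1 m2 h1 h2.
  rewrite [X in (X <= _)%E](_ : _ = L2sq T (fun i t =>
      1 * (sp_value (S m) i t w - H m i t w) + 1 * (H m i t w - H0 i t w))%R); last first.
    apply: eq_integral => t _; congr (_%:E); apply: eq_bigr => i _; congr (_ ^+ 2); ring.
  apply: (le_trans (L2sq_lin _ _ _ _)).
  + move=> i; apply: measurable_funB; first exact: measurable_sp_value.
    exact: m1 (ltW T0).
  + by move=> i; apply: measurable_funB; [exact: m1 (ltW T0)|exact: m2 (ltW T0)].
  + rewrite expr1n mulr1.
    apply: (@le_trans _ _ (2%:E * (e / 4)%:E + 2%:E * (e / 4)%:E)%E).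
      by apply: leeD; apply: lee_wpmul2l => //; rewrite lee_fin.
    by rewrite -!EFinM -EFinD lee_fin; lra.
- have c1 : cvg0_in_probability P (fun m w =>
      ereal_sup [set `|sp_integral W (S m) t w - M m t w|%:E | t in `[0%R, T]])%E.
    have := cvg0_in_probability_diag (fun m => proj2 (SP m)).
    move=> c; apply: (cvg0_in_probability_dom2 c c) => e e0; exists e => //.
    near=> m; apply: nearW => w h _; apply: le_trans h; apply: ereal_sup_le.
    apply: image_subset; apply: subset_itvl; rewrite bnd_simp.
    by apply: ltW; apply: (@lt_trans _ _ m%:R); [near: m; exact: nbhs_infty_gtr|rewrite ltr_nat].
  have c2 : cvg0_in_probability P (fun m w =>
      ereal_sup [set `|M m t w - M0 t w|%:E | t in `[0%R, T]])%E.
    have /choice[Y YP] : forall m, exists Y, measurable_fun setT Y /\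
        {ae P, forall w, ereal_sup [set `|M m t w - M0 t w|%:E | t in `[0%R, T]] = Y w}.
      move=> m.
      have aD := adapted_lin 1 (- 1) (ito_adapted (iHM m)) aM0.
      have cD := as_continuous_lin 1 (- 1) (ito_continuous (iHM m)) cM0.
      have [Y mY YE] := ae_sup_measurable (ltW T0) (adapted_measurable hF aD) cD.
      exists Y; split=> //; apply: filterS YE => w <-; congr ereal_sup.
      by apply: eq_imagel => t _; rewrite mul1r mulN1r.
    apply: (@ae_cvg0_in_probability _ _ _ _ _ Y).
    + by move=> m; case: (YP m).
    + by move=> m; case: (YP m).
    + apply: filterS cvgM => w cw e e0; apply: filterS (cw T e T0 e0) => m mP.
      by apply/ereal_supP => _ [t + <-]; rewrite /= in_itv/= => tT; rewrite lee_fin mP.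
  apply: (cvg0_in_probability_dom2 c1 c2) => e e0.
  exists (e / 2); first by rewrite divr_gt0.
  apply: nearW => m; apply: nearW => w /ereal_supP h1 /ereal_supP h2.
  apply/ereal_supP => _ [t tT <-]; rewrite lee_fin.
  have {}h1 : `|sp_integral W (S m) t w - M m t w| <= e / 2.
    by rewrite -lee_fin; apply: h1; exists t.
  have {}h2 : `|M m t w - M0 t w| <= e / 2.
    by rewrite -lee_fin; apply: h2; exists t.
  by rewrite (splitr e) (le_trans (ler_distD (M m t w) _ _))// lerD.
Unshelve. all: by end_near. Qed.

End ito_limits.

(** * Difference quotients and dominated convergence *)

Section difference_quotients.
Context {R : realType}.
Notation leb := (@lebesgue_measure R).
Implicit Types (f : R -> R) (x y T e : R).

Definition diffq f x (m : nat) : R := m.+1%:R * (f (x + m.+1%:R^-1) - f x).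

Lemma cvg_diffq f x : derivable f x 1 -> diffq f x m @[m --> \oo] --> derive1 f x.
Proof.
move=> df; apply/cvgrPdist_lt => e e0; have [r r0 rP] := derive1_dist df e0.
near=> m; rewrite /diffq.
have := rP m.+1%:R^-1; rewrite invrK (addrC _ x); apply; first exact: invr_neq0.
rewrite ger0_norm ?invr_ge0//; near: m; exact: near_infty_natSinv_lt (PosNum r0).
Unshelve. all: by end_near. Qed.

Lemma cvg_diffq_lin f x : derivable f x 1 ->
  m.+1%:R * f (x + m.+1%:R^-1) + (- m.+1%:R) * f x @[m --> \oo] --> derive1 f x.
Proof.
move=> /cvg_diffq; apply: cvg_trans; apply: near_eq_cvg; apply: nearW => m.
by rewrite /diffq; ring.
Qed.

Lemma diffq_MVT f x m : 0 < x -> (forall y, 0 < y -> derivable f y 1) ->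
  exists2 y, x < y < x + m.+1%:R^-1 & diffq f x m = derive1 f y.
Proof.
move=> x0 df; have v0 : 0 < m.+1%:R^-1 :> R by rewrite invr_gt0.
have [|y xy E] := @MVT_pos _ f x (x + m.+1%:R^-1) x0 _ df; first by rewrite ltrDl.
by exists y => //; rewrite /diffq E addrAC subrr add0r mulrCA mulfV ?mulr1.
Qed.

Lemma diffq_MVT1 f x m : 0 < x -> (forall y, 0 < y -> derivable f y 1) ->
  exists2 y, x <= y <= x + 1 & diffq f x m = derive1 f y.
Proof.
move=> x0 df; have [y /andP[xy yx] E] := diffq_MVT m x0 df; exists y => //.
have : m.+1%:R^-1 <= 1 :> R by rewrite invf_le1// ler1n.
by move: yx; move: (m.+1%:R^-1) => v; lra.
Qed.

Lemma measurable_diffq {d} {T : measurableType d} (D : set T) (g : T -> R -> R) x m :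
  0 < x -> (forall y, 0 < y -> measurable_fun D (g ^~ y)) ->
  measurable_fun D (fun t => diffq (g t) x m).
Proof.
move=> x0 mg; apply: measurable_funM; first exact: measurable_cst.
by apply: measurable_funB; apply: mg; rewrite // addr_gt0// invr_gt0.
Qed.

Lemma measurable_derive1 {d} {T : measurableType d} (D : set T) (g : T -> R -> R) x :
  0 < x -> (forall y, 0 < y -> measurable_fun D (g ^~ y)) ->
  (forall t, D t -> derivable (g t) x 1) ->
  measurable_fun D (fun t => derive1 (g t) x).
Proof.
move=> x0 mg dg; apply: (@measurable_fun_cvg _ _ _ _ (fun m t => diffq (g t) x m)).
  by move=> m; exact: measurable_diffq.
by move=> t Dt; apply: cvg_diffq; exact: dg.
Qed.

Lemma measurable_itv0 T : measurable (`[0, T] : set R).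
Proof. exact: measurable_itv. Qed.

(** A supremum of continuous functions over a compact interval is a supremum
    over a countable set, hence measurable in the parameter; it can then serve
    as a dominating function. *)
Lemma integrable_sup_bound (E : set R) (h : R -> R -> R) (a b : R) :
  measurable E -> a <= b ->
  (forall t y, 0 <= h t y) ->
  (forall y, a <= y <= b -> measurable_fun E (h ^~ y)) ->
  (forall t, E t -> {within `[a, b], continuous (h t)}) ->
  (\int[leb]_(t in E) ereal_sup [set (h t y)%:E | y in `[a, b]] < +oo)%E ->
  exists2 D : R -> R, leb.-integrable E (EFin \o D) &
    forall t y, E t -> a <= y <= b -> h t y <= D t.
Proof.
move=> mE ab h0 mh ch intS.
pose D t := esups (fun k => (h t (clamp a b (rat_seq k)))%:E) 0.
have DE t : E t -> D t = ereal_sup [set (h t y)%:E | y in `[a, b]].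
  move=> Et; rewrite /D -(@ereal_sup_clamp _ a b (h t))// => z zab e e0.
  have /within_continuous_dist := ch t Et.
  have zab' : `[a, b]%classic z by rewrite /= in_itv.
  move=> /(_ z zab' e e0)[r r0 rP].
  by exists r => // s sab zs; apply: rP => //=; rewrite in_itv.
have Dh t y : E t -> a <= y <= b -> ((h t y)%:E <= D t)%E.
  by move=> Et yab; rewrite DE//; apply: ereal_sup_ubound; exists y => //=; rewrite in_itv.
have D0 t : E t -> (0 <= D t)%E.
  by move=> Et; apply: le_trans (Dh t a Et _); rewrite ?lee_fin ?h0// lexx.
have Dfin t : E t -> D t \is a fin_num.
  move=> Et; rewrite ge0_fin_numE ?D0// DE//.
  have [c _ hc] := EVT_max ab (ch t Et).
  apply: (@le_lt_trans _ _ (h t c)%:E); last exact: ltry.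
  by apply/ereal_supP => _ [y yab <-]; rewrite lee_fin hc.
have mD : measurable_fun E D.
  by apply: measurable_fun_esups => k; apply/measurable_EFinP; apply: mh; exact: clamp_in.
exists (fine \o D); last by move=> t y Et yab; rewrite -lee_fin /= fineK ?Dfin// Dh.
apply/integrableP; split.
  by apply: (eq_measurable_fun D) => // t /set_mem Et /=; rewrite fineK// Dfin.
apply: le_lt_trans intS; apply: ge0_le_integral_nonmeas => [t _|t Et]; first exact: abse_ge0.
by rewrite -[X in (X <= _)%E]/(`|(fine (D t))%:E|)%E fineK ?Dfin// gee0_abs ?D0// DE.
Qed.

Lemma dominated_cvg0_int (f : nat -> R -> R) (D : R -> R) T :
  leb.-integrable `[0, T] (EFin \o D) ->
  (forall m, measurable_fun `[0, T] (f m)) ->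
  (forall m t, 0 <= t <= T -> `|f m t| <= D t) ->
  (forall t, 0 <= t <= T -> f m t @[m --> \oo] --> 0) ->
  forall e, 0 < e -> \forall m \near \oo, (\int[leb]_(t in `[0%R, T]) `|f m t|%:E <= e%:E)%E.
Proof.
move=> iD mf fD f0 e e0.
have mf' m : measurable_fun `[0, T] (EFin \o f m) by exact/measurable_EFinP.
have cf : {ae leb, forall t, `[0, T]%classic t -> (EFin \o f m) t @[m --> \oo] --> (cst 0%E) t}.
  by apply: aeW => t /=; rewrite in_itv/= => tT; apply: cvg_EFin; [exact: nearW|exact: f0].
have df : {ae leb, forall t m, `[0, T]%classic t -> (`|(EFin \o f m) t| <= (EFin \o D) t)%E}.
  by apply: aeW => t m /=; rewrite in_itv/= => tT; rewrite lee_fin; exact: fD.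
have [_ + _] := @dominated_convergence _ _ R leb _ (measurable_itv0 T) _ _ _ mf' (measurable_cst _) cf iD df.
move=> /fine_cvgP[fin /cvgrPdist_lt/(_ _ e0)] c.
apply: filterS2 fin c => m /= fm; rewrite sub0r normrN => c.
rewrite (_ : (fun t => _) = (fun t => `|(f m t)%:E - 0|)%E); last first.
  by apply/funext => t; rewrite sube0.
by rewrite -(fineK fm) lee_fin (le_trans (ler_norm _))// ltW.
Qed.

End difference_quotients.

Section pathwise_limits.
Context {R : realType}.
Notation leb := (@lebesgue_measure R).

(** The mean value theorem bounds the difference quotients by the supremum of the
    derivative over [[x, x + 1]], whose square is integrable in time. *)
Lemma quotient_L2 n (g : 'I_n -> R -> R -> R) (x T : R) : 0 < x ->
  (forall i t, 0 <= t -> Cm 1 (g i t)) ->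
  (forall i y, 0 < y -> measurable_fun `[0, T] (fun t => g i t y)) ->
  (\int[leb]_(t in `[0%R, T]) ereal_sup
     [set (enorm (fun i => derive1 (g i t) y) ^+ 2)%:E | y in `[x, (x + 1)%R]] < +oo)%E ->
  forall e, 0 < e -> \forall m \near \oo,
    (L2sq T (fun i t => (diffq (g i t) x m - derive1 (g i t) x)%R) <= e%:E)%E.
Proof.
move=> x0 cg mg intS e e0.
have x1 : x <= x + 1 by lra.
have tT0 t : 0 <= t <= T -> 0 <= t by case/andP.
have pos y : x <= y <= x + 1 -> 0 < y by lra.
have enormE i t y : (derive1 (g i t) y) ^+ 2 <= enorm (fun j => derive1 (g j t) y) ^+ 2.
  rewrite /enorm sqr_sqrtr ?sumr_ge0//; last by move=> j _; exact: sqr_ge0.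
  by rewrite (bigD1 i)//= lerDl sumr_ge0// => j _; exact: sqr_ge0.
have mdg y i : 0 < y -> measurable_fun `[0, T] (fun t => derive1 (g i t) y).
  move=> y0; apply: (measurable_derive1 y0) => [z z0|t]; first exact: mg.
  by rewrite /= in_itv/= => /tT0 t0; have [/(_ 0%N isT _ y0)] := cg i t t0.
have tTE t : `[0, T]%classic t = (0 <= t <= T) by rewrite /= in_itv.
have [|y xy|t tT|D iD DP] := @integrable_sup_bound _ _
    (fun t y => enorm (fun i => derive1 (g i t) y) ^+ 2) _ _ (measurable_itv0 T) x1 _ _ _ intS.
- by move=> t y; exact: sqr_ge0.
- rewrite (_ : (fun t => _) = (fun t => sqnorm (fun i t => derive1 (g i t) y) t)).
    by apply: measurable_sqnorm => i; apply: mdg; exact: pos.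
  apply/funext => t; rewrite /enorm sqr_sqrtr ?sumr_ge0// => j _; exact: sqr_ge0.
- rewrite (_ : (fun y => _) = (fun y => \sum_i derive1 (g i t) y ^+ 2)); last first.
    apply/funext => y; rewrite /enorm sqr_sqrtr ?sumr_ge0// => j _; exact: sqr_ge0.
  apply: within_pos_continuous => // y y0.
  apply: cvg_big => [|i _]; first exact: add_continuous.
  have [_ /(_ _ y0) cgi] := cg i t (tT0 _ tT).
  exact: (cvgM cgi cgi).
have iD' : leb.-integrable `[0, T] (EFin \o (fun t => (n%:R * 4) * D t)).
  have := @integrableZl _ _ _ leb _ (measurable_itv0 T) (n%:R * 4) _ iD.
  by apply: eq_integrable => //; exact: measurable_itv0.
have bnd i m t : 0 <= t <= T ->
    (diffq (g i t) x m - derive1 (g i t) x) ^+ 2 <= 4 * D t.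
  move=> tT; have dg y : 0 < y -> derivable (g i t) y 1.
    by move=> y0; have [/(_ 0%N isT _ y0)] := cg i t (tT0 _ tT).
  have [y xy ->] := diffq_MVT1 m x0 dg.
  rewrite -tTE in tT.
  have h1 := le_trans (enormE i t y) (DP t y tT xy).
  have h2 : derive1 (g i t) x ^+ 2 <= D t.
    by apply: le_trans (enormE i t x) (DP t x tT _); rewrite lexx x1.
  have := sqr_ge0 (derive1 (g i t) y + derive1 (g i t) x).
  set p := derive1 _ y in h1 *; set q := derive1 _ x in h2 *.
  rewrite sqrrD sqrrB; lra.
have gE (f : 'I_n -> R -> R) : (L2sq T f = \int[leb]_(t in `[0%R, T]) `|sqnorm f t|%:E)%E.
  by apply: eq_integral => t _; rewrite ger0_norm// sqnorm_ge0.
pose f m t := sqnorm (fun i t => diffq (g i t) x m - derive1 (g i t) x) t.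
have mf m : measurable_fun `[0, T] (f m).
  apply: measurable_sqnorm => i; apply: measurable_funB; last exact: mdg.
  by apply: measurable_diffq => // y y0; exact: mg.
have fD m t : 0 <= t <= T -> `|f m t| <= n%:R * 4 * D t.
  move=> tT; rewrite ger0_norm ?sqnorm_ge0// /f /sqnorm.
  have -> : n%:R * 4 * D t = \sum_(i < n) (4 * D t).
    by rewrite sumr_const card_ord -mulrA mulr_natl.
  by apply: ler_sum => i _; exact: bnd.
have f0 t : 0 <= t <= T -> f m t @[m --> \oo] --> 0.
  move=> tT; rewrite (_ : 0 = \sum_(i < n) (0 : R)); last by rewrite big1.
  apply: cvg_big => [|i _]; first exact: add_continuous.
  have [/(_ 0%N isT _ x0)/cvg_diffq dg _] := cg i t (tT0 _ tT).
  have h : diffq (g i t) x m - derive1 (g i t) x @[m --> \oo] --> 0.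
    by rewrite -(subrr (derive1 (g i t) x)); apply: cvgB => //; exact: cvg_cst.
  by rewrite -[X in _ --> X](mulr0 0); exact: (cvgM h h).
by apply: filterS (dominated_cvg0_int iD' mf fD f0 e0) => m; rewrite gE.
Qed.

(** The analogue of [quotient_L2] for a drift, where only the first power of the
    supremum is integrable. *)
Lemma quotient_L1 (g : R -> R -> R) (x T : R) : 0 < x ->
  (forall t, 0 <= t -> Cm 1 (g t)) ->
  (forall y, 0 < y -> measurable_fun `[0, T] (fun t => g t y)) ->
  (\int[leb]_(t in `[0%R, T]) ereal_sup
     [set `|derive1 (g t) y|%:E | y in `[x, (x + 1)%R]] < +oo)%E ->
  leb.-integrable `[0, T] (fun t => (derive1 (g t) x)%:E) /\
  forall e, 0 < e -> \forall m \near \oo,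
    (\int[leb]_(t in `[0%R, T]) `|diffq (g t) x m - derive1 (g t) x|%:E <= e%:E)%E.
Proof.
move=> x0 cg mg intS.
have x1 : x <= x + 1 by lra.
have tT0 t : 0 <= t <= T -> 0 <= t by case/andP.
have pos y : x <= y <= x + 1 -> 0 < y by lra.
have mdg y : 0 < y -> measurable_fun `[0, T] (fun t => derive1 (g t) y).
  move=> y0; apply: (measurable_derive1 y0) => [z z0|t]; first exact: mg.
  by rewrite /= in_itv/= => /tT0 t0; have [/(_ 0%N isT _ y0)] := cg t t0.
have [|y xy|t tT|D iD DP] := @integrable_sup_bound _ _
    (fun t y => `|derive1 (g t) y|) _ _ (measurable_itv0 T) x1 _ _ _ intS.
- by move=> t y; exact: normr_ge0.
- by apply: measurableT_comp => //; apply: mdg; exact: pos.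
- apply: within_pos_continuous => // y y0.
  by have [_ /(_ _ y0)] := cg t (tT0 _ tT); exact: cvg_norm.
have iD' : leb.-integrable `[0, T] (EFin \o (fun t => 2 * D t)).
  have := @integrableZl _ _ _ leb _ (measurable_itv0 T) 2 _ iD.
  by apply: eq_integrable => //; exact: measurable_itv0.
have xx : x <= x <= x + 1 by rewrite lexx.
split.
  apply: (@le_integrable _ _ _ leb _ (measurable_itv0 T) _ (EFin \o D)) => //.
    by apply/measurable_EFinP; exact: mdg.
  by move=> t tT; rewrite lee_fin (le_trans (DP t x tT xx))// ler_norm.
move=> e e0.
have := @dominated_cvg0_int _ (fun m t => diffq (g t) x m - derive1 (g t) x) _ T iD'.
apply => //.
- move=> m; apply: measurable_funB; last exact: mdg.
  by apply: measurable_diffq => // y y0; exact: mg.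
- move=> m t tT; have dg y : 0 < y -> derivable (g t) y 1.
    by move=> y0; have [/(_ 0%N isT _ y0)] := cg t (tT0 _ tT).
  have [y xy ->] := diffq_MVT1 m x0 dg.
  have tE : `[0, T]%classic t by rewrite /= in_itv.
  rewrite (le_trans (ler_normB _ _))// mulr_natl mulr2n.
  by apply: lerD; exact: DP.
- move=> t tT; have [/(_ 0%N isT _ x0)/cvg_diffq dg _] := cg t (tT0 _ tT).
  by rewrite -(subrr (derive1 (g t) x)); apply: cvgB => //; exact: cvg_cst.
Qed.

(** By the mean value theorem the difference quotient is a value of the
    derivative near [x]; joint continuity on the compact interval [[0, T]] makes
    the convergence uniform in time. *)
Lemma quotient_unif (V : R -> R -> R) (x : R) : 0 < x ->
  (forall t y, 0 <= t -> 0 < y -> derivable (V t) y 1) ->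
  {within times `*` positives, continuous (fun p : R * R => derive1 (V p.1) p.2)} ->
  forall T e : R, 0 < e -> \forall m \near \oo,
    forall t, 0 <= t <= T -> `|diffq (V t) x m - derive1 (V t) x| <= e.
Proof.
move=> x0 dV /within_continuous_dist cV T e e0.
have e2 : 0 < e / 2 by lra.
pose Q y t := 0 <= t <= T -> 0 < y -> `|derive1 (V t) y - derive1 (V t) x| < e.
have /compact_near_coveringP ncov := segment_compact (a := 0) (b := T).
have : \forall y \near x, `[0, T]%classic `<=` Q y.
  apply: (ncov _ (nbhs x) Q) => t /=; rewrite in_itv/= => tT.
  have dom (s y : R) : 0 <= s <= T -> 0 < y -> (times `*` positives) (s, y).
    by move=> /andP[s0 _] y0; split; rewrite /times/positives/= in_itv/= ?s0 ?y0.
  have [r r0 rP] := cV (t, x) (dom t x tT x0) _ e2.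
  near=> s y => sT y0.
  have s1 : ball t r s by near: s; exact: nbhsx_ballx.
  have y1 : ball x r y by near: y; exact: nbhsx_ballx.
  have h1 := rP (s, y) (dom _ _ sT y0) (conj s1 y1).
  have h2 := rP (s, x) (dom _ _ sT x0) (conj s1 (ballxx _ r0)).
  rewrite (splitr e) (le_lt_trans (ler_distD (derive1 (V t) x) _ _))// ltrD//.
  by rewrite distrC; exact: h1.
move=> /nbhs_ballP[r /= r0 rP]; near=> m => t tT.
have dg y : 0 < y -> derivable (V t) y 1 by move=> y0; apply: dV => //; case/andP: tT.
have [y /andP[xy yx] ->] := diffq_MVT m x0 dg.
have mr : m.+1%:R^-1 < r by near: m; exact: near_infty_natSinv_lt (PosNum r0).
apply/ltW; apply: (rP y) => //=; rewrite ?in_itv//.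
- rewrite /ball/= ltr_norml; move: mr yx; move: (m.+1%:R^-1) => v; lra.
- lra.
Unshelve. all: by end_near. Qed.

End pathwise_limits.

(** * Differentiating an Ito random field in space *)

Section field_derivative.
Context {R : realType} {d : measure_display} {Omega : measurableType d}.
Variables (P : probability Omega R) (F : R -> set (set Omega)).
Hypothesis hF : usual_filtration P F.
Variables (n : nat) (W : 'I_n -> R -> Omega -> R).
Notation leb := (@lebesgue_measure R).

Lemma le_norm_Rintegral_itv (f : R -> R) (t T e : R) : t <= T ->
  leb.-integrable `[0, t] (EFin \o f) ->
  (\int[leb]_(s in `[0%R, T]) `|f s|%:E <= e%:E)%E ->
  `|\int[leb]_(s in `[0, t]) f s| <= e.
Proof.
move=> tT fi fe; apply: (le_trans (@le_normr_Rintegral _ _ _ leb _ _ (measurable_itv0 t) fi)).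
have h : (\int[leb]_(s in `[0%R, t]) `|f s|%:E <= e%:E)%E.
  apply: le_trans fe; apply: subset_ge0_le_integral => //.
  - by apply: subset_itvl; rewrite bnd_simp.
  - by move=> s _; rewrite lexx lee_fin normr_ge0.
rewrite /Rintegral -lee_fin fineK// ge0_fin_numE; first exact: le_lt_trans h (ltry _).
by apply: integral_ge0 => s _; rewrite lee_fin.
Qed.

Lemma integrable_itvB (f g : R -> R) (t : R) :
  leb.-integrable `[0, t] (EFin \o f) -> leb.-integrable `[0, t] (EFin \o g) ->
  leb.-integrable `[0, t] (EFin \o (fun s => f s - g s)).
Proof.
move=> fi gi; have := @integrableB _ _ _ leb _ (measurable_itv0 t) _ _ fi gi.
by apply: eq_integrable => // s _ /=; rewrite -EFinB.
Qed.

Lemma integrable_itvZ (k : R) (f : R -> R) (t : R) :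
  leb.-integrable `[0, t] (EFin \o f) ->
  leb.-integrable `[0, t] (EFin \o (fun s => k * f s)).
Proof.
move=> fi; have := @integrableZl _ _ _ leb _ (measurable_itv0 t) k _ fi.
by apply: eq_integrable => // s _ /=; rewrite -EFinM.
Qed.

Lemma compact_itv_positives (x : R) : 0 < x ->
  compact (`[x, x + 1]%classic : set R) /\ `[x, x + 1]%classic `<=` positives.
Proof.
move=> x0; split; first exact: segment_compact.
by move=> y /=; rewrite /positives/= !in_itv/= andbT; lra.
Qed.

Lemma nat_bound (T : R) : exists N : nat, T <= N.+1%:R.
Proof.
have [N TN] := filter_ex (nbhs_infty_ger T); exists N.
by rewrite (le_trans TN)// ler_nat.
Qed.

Lemma ae_loc_sup k p (f : 'I_p -> R -> R -> Omega -> R) x : 0 < x ->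
  loc_sup_integrable P k f ->
  {ae P, forall w, forall N : nat, (\int[leb]_(t in `[0%R, N.+1%:R])
    ereal_sup [set (enorm (fun i => f i t y w) ^+ k)%:E | y in `[x, (x + 1)%R]] < +oo)%E}.
Proof.
move=> x0 hf; have [cK Kpos] := compact_itv_positives x0.
by apply: ae_foralln => N; apply: hf.
Qed.

Lemma enorm1 (f : 'I_1 -> R) : enorm f = `|f ord0|.
Proof. by rewrite /enorm big_ord1 sqrtr_sqr. Qed.

Lemma spatially_forall p (f : 'I_p -> R -> R -> Omega -> R) Q :
  (forall i, spatially P Q (f i)) ->
  {ae P, forall w, forall i (t : R), 0 <= t -> Q (fun x => f i t x w)}.
Proof. by move=> fQ; apply: filter_forall => i; exact: fQ. Qed.

Section drift.
Variable b : R -> R -> Omega -> R.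
Hypothesis hb : progressive_field F b.
Hypothesis Kb : Kloc P 1 (fun _ : 'I_1 => b).

(** Integer horizons suffice, so that a single null set serves for all horizons. *)
Lemma Kloc_drift_derive (x : R) : 0 < x ->
  {ae P, forall w, forall N : nat,
    leb.-integrable `[0, N.+1%:R] (fun t => (Dx 1 b t x w)%:E) /\
    forall e, 0 < e -> \forall m \near \oo,
      (\int[leb]_(t in `[0%R, N.+1%:R])
         `|diffq (fun y => b t y w) x m - Dx 1 b t x w|%:E <= e%:E)%E}.
Proof.
move=> x0; have [/(_ ord0) Cb _ /(_ 1%N isT) supb] := Kb.
apply: filterS2 Cb (ae_loc_sup x0 supb) => w Cbw supw N.
apply: (@quotient_L1 _ (fun t y => b t y w)) => //.
- move=> y y0; apply: (progressive_section (X := b ^~ y)); last by [].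
  exact: field_progressive hb _ y0.
- have := supw N; congr (_ < _)%E; apply: eq_integral => t _.
  by congr ereal_sup; apply: eq_imagel => y _; rewrite enorm1.
Qed.

End drift.

(** The difference quotients of an Ito field are Ito integrals that converge, in the
    sense of [ito_integral_lim], to the derivative. For the diffusion and the drift this
    is dominated convergence; for the field itself it is the joint continuity of
    its derivative. *)
Lemma ito_field_derive b c X (x : R) : 0 < x ->
  ito_field P F W b c X ->
  {ae P, forall w, forall t y : R, 0 <= t -> 0 < y -> derivable (fun y => X t y w) y 1} ->
  continuous_field P (Dx 1 X) ->
  Kloc P 1 (fun _ : 'I_1 => b) -> Kbarloc P 1 c ->
  ito_integral P F W (fun i t w => Dx 1 (c i) t x w)
    (fun t w => Dx 1 X t x w - Dx 1 X 0 x w -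
       time_integral (fun s v => Dx 1 b s x v) t w).
Proof.
move=> x0 hX dX cX Kb Kc.
have xm0 m : 0 < x + m.+1%:R^-1 by rewrite addr_gt0// invr_gt0.
apply: (ito_integral_lim hF
  (H := fun m i t w => m.+1%:R * c i t (x + m.+1%:R^-1) w + (- m.+1%:R) * c i t x w)
  (M := fun m t w => m.+1%:R * MF X b t (x + m.+1%:R^-1) w + (- m.+1%:R) * MF X b t x w)).
- move=> m; apply: (@ito_integral_lin _ _ _ _ _ hF _ _ _ _
    (fun i => c i ^~ (x + m.+1%:R^-1)) (fun i => c i ^~ x)
    (MF X b ^~ (x + m.+1%:R^-1)) (MF X b ^~ x)).
  + exact: ito_field_integral hX _ (xm0 m).
  + exact: ito_field_integral hX _ x0.
- have [Cc _ _] := Kc; have {}Cc := spatially_forall Cc.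
  apply: filterS Cc => w Cw i t t0.
  by have [/(_ 0%N isT x x0)/cvg_diffq_lin + _] := Cw i t t0.
- have [Cc _ /(_ 1%N isT) supc] := Kc; have {}Cc := spatially_forall Cc.
  apply: filterS2 Cc (ae_loc_sup x0 supc) => w Cw supw T e T0 e0.
  have [N TN] := nat_bound T.
  have := @quotient_L2 _ n (fun i t y => c i t y w) x N.+1%:R x0 _ _ (supw N) e e0.
  move=> H; apply: filterS (H _ _).
  + move=> m mP; apply: le_trans (le_trans (le_L2sq _ TN) mP).
    rewrite le_eqVlt; apply/orP; left; apply/eqP; apply: eq_integral => t _.
    congr (_%:E); apply: eq_bigr => i _; congr (_ ^+ 2).
    by rewrite /diffq /Dx/=; ring.
  + by move=> i t t0; exact: Cw.
  + move=> i y y0; apply: (progressive_section (X := c i ^~ y)); last by [].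
    exact: field_progressive (ito_field_diffusion hX i) _ y0.
- have ib : {ae P, forall w, forall m, forall T : R, 0 < T ->
      leb.-integrable `[0, T] (EFin \o (fun t => b t (x + m.+1%:R^-1) w))}.
    by apply: ae_foralln => m; exact: ito_field_integrable hX _ (xm0 m).
  apply: filterS2 (filterI dX cX)
    (filterI (Kloc_drift_derive (ito_field_drift hX) Kb x0)
       (filterI ib (ito_field_integrable hX x0))).
  move=> w [dXw cXw] [Kw [ibw ibxw]] T e T0 e0.
  have e3 : 0 < e / 3 by lra.
  have [N TN] := nat_bound T.
  have [ibx L1] := Kw N.
  have u1 := @quotient_unif _ (fun t y => X t y w) x x0 dXw cXw T _ e3.
  apply: filterS2 u1 (L1 _ e3) => m u1m L1m t tT.
  have {}t0 : 0 <= t by case/andP: tT.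
  have sub : `[0, t]%classic `<=` `[0, N.+1%:R]%classic.
    by apply: subset_itvl; rewrite bnd_simp; lra.
  have it (f : R -> R) : leb.-integrable `[0, N.+1%:R] (EFin \o f) ->
      leb.-integrable `[0, t] (EFin \o f).
    by apply: integrableS => //; exact: measurable_itv0.
  have N0 : 0 < N.+1%:R :> R by [].
  have i1 := it _ (ibw m _ N0); have i2 := it _ (ibxw _ N0); have i3 := it _ ibx.
  have mt := measurable_itv0 t.
  have i4 : leb.-integrable `[0, t] (EFin \o (fun s => diffq (fun y => b s y w) x m)).
    by apply: integrable_itvZ; exact: integrable_itvB.
  have Dint : m.+1%:R * BF b t (x + m.+1%:R^-1) w - m.+1%:R * BF b t x w -
      time_integral (fun s v => Dx 1 b s x v) t w =
      \int[leb]_(s in `[0, t]) (diffq (fun y => b s y w) x m - Dx 1 b s x w).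
    rewrite (@RintegralB _ _ _ leb)//.
    by rewrite /diffq (@RintegralZl _ _ _ leb) ?(@RintegralB _ _ _ leb) ?mulrBr//; exact: integrable_itvB.
  have h3 : `|\int[leb]_(s in `[0, t]) (diffq (fun y => b s y w) x m - Dx 1 b s x w)| <= e / 3.
    by apply: (le_norm_Rintegral_itv _ _ L1m); [lra|exact: integrable_itvB].
  have h1 := u1m t tT; have h2 := u1m 0 ltac:(lra).
  rewrite (_ : _ - _ = (diffq (fun y => X t y w) x m - derive1 (fun y => X t y w) x)
    - (diffq (fun y => X 0 y w) x m - derive1 (fun y => X 0 y w) x)
    - (m.+1%:R * BF b t (x + m.+1%:R^-1) w - m.+1%:R * BF b t x w -
      time_integral (fun s v => Dx 1 b s x v) t w)); last first.
    by rewrite /MF /diffq /Dx/=; ring.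
  rewrite Dint (le_trans (ler_normB _ _))//.
  by rewrite (le_trans (lerD (ler_normB _ _) (lexx _)))//; lra.
Qed.

End field_derivative.

(** * The equation of the marginal utility *)

Section necessary_condition.
Context {R : realType} {d : measure_display} {Omega : measurableType d}.
Variables (P : probability Omega R) (F : R -> set (set Omega)).
Hypothesis hF : usual_filtration P F.
Notation leb := (@lebesgue_measure R).

Lemma eq_conjugate (f g : R -> R) : (forall x, 0 < x -> f x = g x) ->
  conjugate f = conjugate g.
Proof.
move=> fg; apply/funext => y; congr sup; apply: eq_imagel => x.
by rewrite /positives/= in_itv/= andbT => x0; rewrite fg.
Qed.

Lemma derive1_conjugate_surj (u : R -> R) z : utility_function u -> 0 < z ->
  0 < - derive1 (conjugate u) z /\ derive1 u (- derive1 (conjugate u) z) = z.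
Proof.
move=> hu z0; have [x x0 <-] := utility_derive1_surj hu z0.
by rewrite derive1_conjugate// opprK.
Qed.

Lemma derive1_conjugate_decr (u : R -> R) y z : utility_function u ->
  0 < y -> y < z -> - derive1 (conjugate u) z < - derive1 (conjugate u) y.
Proof.
move=> hu y0 yz; have [x0 xy] := derive1_conjugate_surj hu y0.
have [v0 vz] := derive1_conjugate_surj hu (lt_trans y0 yz).
move: x0 v0 xy vz; set x := - derive1 _ y; set v := - derive1 _ z => x0 v0 xy vz.
rewrite ltNge le_eqVlt; apply/negP => /predU1P[xv|xv].
  by move: yz; rewrite -xy -vz xv ltxx.
by have := utility_derive1_lt hu x0 xv; rewrite xy vz ltNge (ltW yz).
Qed.

Lemma progressive_adapted (X : R -> Omega -> R) : progressive F X -> adapted F X.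
Proof.
move=> pX t t0.
apply: (@measurable_comp _ _ _ _ (R * g_sigma_algebraType (F t))%type _ (`[0, t] `*` setT)
  (fun p => X p.1 p.2) _ (fun w : g_sigma_algebraType (F t) => (t : R, w))).
- exact: measurable_strip.
- by move=> _ [w _ <-]; split => //=; rewrite in_itv/= t0 lexx.
- exact: pX.
- by apply: measurable_fun_pair => //; exact: measurable_cst.
Qed.

Lemma eq_as_progressive (X Y : R -> Omega -> R) :
  {ae P, forall w, forall t, 0 <= t -> Y t w = X t w} ->
  as_progressive P F X -> as_progressive P F Y.
Proof.
move=> YX [X' pX' XX']; exists X' => //.
by apply: filterS2 YX XX' => w h1 h2 t t0; rewrite h1// h2.
Qed.

Lemma as_progressive_Dx1 (X : R -> R -> Omega -> R) x : 0 < x ->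
  progressive_field F X ->
  {ae P, forall w, forall t : R, 0 <= t -> derivable (fun y => X t y w) x 1} ->
  as_progressive P F (fun t w => Dx 1 X t x w).
Proof.
move=> x0 pX dX.
have as_p y : 0 < y -> as_progressive P F (X ^~ y).
  move=> y0; exists (X ^~ y); first exact: field_progressive pX _ y0.
  by apply: aeW.
apply: (as_progressive_lim hF
  (X := fun m t w => m.+1%:R * X t (x + m.+1%:R^-1) w + (- m.+1%:R) * X t x w)).
  move=> m; apply: (as_progressive_lin m.+1%:R (- m.+1%:R)
    (as_p (x + m.+1%:R^-1) _) (as_p x x0)).
  by rewrite addr_gt0// invr_gt0.
apply: filterS dX => w dXw t t0.
exact: (cvg_diffq_lin (dXw t t0)).
Qed.

Lemma adapted_Dx1 (X : R -> R -> Omega -> R) x : 0 < x ->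
  progressive_field F X ->
  {ae P, forall w, forall t : R, 0 <= t -> derivable (fun y => X t y w) x 1} ->
  adapted F (fun t w => Dx 1 X t x w).
Proof.
move=> x0 pX dX.
have ad y : 0 < y -> adapted F (X ^~ y).
  by move=> y0; apply: progressive_adapted; exact: field_progressive pX _ y0.
apply: (adapted_lim hF
  (X := fun m t w => m.+1%:R * X t (x + m.+1%:R^-1) w + (- m.+1%:R) * X t x w)).
  move=> m; apply: (adapted_lin m.+1%:R (- m.+1%:R)
    (ad (x + m.+1%:R^-1) _) (ad x x0)).
  by rewrite addr_gt0// invr_gt0.
apply: filterS dX => w dXw t t0.
exact: (cvg_diffq_lin (dXw t t0)).
Qed.

Lemma continuous_field_at (X : R -> R -> Omega -> R) x : 0 < x ->
  continuous_field P X -> as_continuous P (X ^~ x).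
Proof.
move=> x0; apply: filterS => w /within_continuous_dist cX.
apply/within_continuous_dist => t tt e e0.
have px : positives x by rewrite /positives/= in_itv/= x0.
have [r r0 rP] := cX (t, x) (conj tt px) e e0; exists r => // s ss ts.
exact: (rP (s, x) (conj ss px) (conj ts (ballxx _ r0))).
Qed.

(** A constant sequence of stochastic integrals converges to any integrand and
    process indistinguishable from its own. *)
Lemma eq_ito_integral n (W : 'I_n -> R -> Omega -> R) (H H' : 'I_n -> R -> Omega -> R) M M' :
  {ae P, forall w, forall i (t : R), 0 <= t -> H i t w = H' i t w} ->
  {ae P, forall w, forall t : R, 0 <= t -> M t w = M' t w} ->
  ito_integral P F W H M -> ito_integral P F W H' M'.
Proof.
move=> HH' MM' iHM; apply: (ito_integral_lim hF (H := fun=> H) (M := fun=> M)) => //.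
- by apply: filterS HH' => w Hw i t t0; rewrite Hw//; exact: cvg_cst.
- apply: filterS HH' => w Hw T e T0 e0; apply: nearW => m.
  rewrite /L2sq integral0_eq ?lee_fin ?ltW// => t /=; rewrite in_itv/= => /andP[t0 _].
  by rewrite /sqnorm big1// => i _; rewrite Hw// subrr expr0n.
- apply: filterS MM' => w Mw T e T0 e0; apply: nearW => m t /andP[t0 _].
  by rewrite Mw// subrr normr0 ltW.
Qed.

Section utility_field.
Variables (n : nat) (W : 'I_n -> R -> Omega -> R) (u : R -> R).
Variables (b : R -> R -> Omega -> R) (c : 'I_n -> R -> R -> Omega -> R).
Variable U : R -> R -> Omega -> R.
Hypothesis hX : ito_field P F W b c U.
Hypothesis U0 : {ae P, forall w, forall x : R, 0 < x -> U 0 x w = u x}.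
Hypothesis hU : progressive_utility P F U.
Hypothesis Kb : Kloc P 1 (fun _ : 'I_1 => b).
Hypothesis Kc : Kbarloc P 1 c.

(** [u] itself is only known on the positive half-line, through one path of [U]. *)
Let initial_utility : exists u0 : R -> R, utility_function u0 /\
  forall x, 0 < x -> u0 x = u x.
Proof.
have pf : ProperFilter (almost_everywhere P).
  apply: ae_properfilter_algebraOfSetsType.
  by rewrite [X in (_ < X)%E](_ : _ = 1%E) ?lte01//; exact: probability_setT.
have := putility_utility hU => H.
have [w [Hw Uw]] := filter_ex (filterI H U0).
by exists (fun x => U 0 x w); split; [exact: Hw|exact: Uw].
Qed.

Let Z (t z : R) w := Dx 1 U t (- derive1 (conjugate u) z) w.

Lemma utility_marginal_increasing : spatially P strictly_increasing Z.
Proof.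
have [u0 [hu0 u0u]] := initial_utility.
apply: filterS (putility_utility hU) => w Uw t t0 y z.
rewrite !in_itv/= !andbT => y0 z0 yz; rewrite /Z -(eq_conjugate u0u).
rewrite /Dx /=; apply: (utility_derive1_lt (Uw t t0)).
  by case: (derive1_conjugate_surj hu0 z0).
exact: derive1_conjugate_decr.
Qed.

(** The starting point [x = - u~'(z)] does not depend on time, and duality gives
    [- U~_y(t, Z_t) = x] along the solution: the coefficients of the equation are
    those of the derivative of the field at [x]. *)
Lemma utility_marginal_sde :
  sde_solution P F W (sde_coef U b) (fun i => sde_coef U (c i)) Z.
Proof.
have [u0 [hu0 u0u]] := initial_utility.
have xP z : 0 < z -> exists2 x, 0 < x /\ derive1 u x = z & forall t w, Z t z w = Dx 1 U t x w.
  move=> z0; have [x0 xz] := derive1_conjugate_surj hu0 z0.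
  exists (- derive1 (conjugate u0) z); last by rewrite /Z (eq_conjugate u0u).
  by rewrite -(eq_pos_derive1 u0u).
have dU : {ae P, forall w, forall t y : R, 0 <= t -> 0 < y -> derivable (fun y => U t y w) y 1}.
  by apply: filterS (putility_utility hU) => w Uw t y t0 y0; exact: utility_derivable (Uw t t0) _ y0.
have coefE (h : R -> R -> Omega -> R) x : 0 < x ->
    {ae P, forall w, forall t : R, 0 <= t ->
      sde_coef U h t (Dx 1 U t x w) w = Dx 1 h t x w}.
  move=> x0; apply: filterS (putility_utility hU) => w Uw t t0.
  have := utility_derive1_gt0 (Uw t t0) x0; rewrite -/(Dx 1 U t x w) => U0x.
  rewrite /sde_coef gt_eqF// /inv_marginal; congr Dx.
  by rewrite (derive1_conjugate (Uw t t0))// opprK.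
have cU : continuous_field P (Dx 1 U) by exact: putility_continuous hU _ _.
have dUx x : 0 < x -> {ae P, forall w, forall t : R, 0 <= t -> derivable (fun y => U t y w) x 1}.
  by move=> x0; apply: filterS dU => w dUw t t0; exact: dUw.
split=> z z0; have [x [x0 uxz] ZE] := xP z z0.
- rewrite (_ : Z ^~ z = (fun t w => Dx 1 U t x w)); last first.
    by apply/funext => t; apply/funext => w; exact: ZE.
  by apply: adapted_Dx1 => //; [exact: putility_field hU|exact: dUx].
- rewrite (_ : Z ^~ z = (fun t w => Dx 1 U t x w)); last first.
    by apply/funext => t; apply/funext => w; exact: ZE.
  exact: continuous_field_at.
- apply: filterS U0 => w U0w; rewrite ZE /Dx/= -uxz.
  by apply: eq_pos_derive1 => // y y0; rewrite U0w// u0u.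
- apply: (@eq_as_progressive (fun t w => Dx 1 b t x w)).
    by apply: filterS (coefE b x x0) => w E t t0; rewrite ZE E.
  apply: as_progressive_Dx1 => //; first exact: ito_field_drift hX.
  have [/(_ ord0) Cb _ _] := Kb; apply: filterS Cb => w Cbw t t0.
  by have [/(_ 0%N isT x x0)] := Cbw t t0.
- apply: filterS2 (coefE b x x0) (Kloc_drift_derive (ito_field_drift hX) Kb x0).
  move=> w E iw T T0; have [N TN] := nat_bound T; have [ibx _] := iw N.
  apply: (@eq_integrable _ _ _ leb _ (measurable_itv0 T) (fun t => (Dx 1 b t x w)%:E)).
    by move=> t /set_mem/=; rewrite in_itv/= => /andP[t0 _]; rewrite ZE E.
  apply: (@integrableS _ _ _ leb _ _ _ (measurable_itv0 _) (measurable_itv0 T) _ ibx).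
  by apply: subset_itvl; rewrite bnd_simp.
- apply: (eq_ito_integral _ _ (ito_field_derive hF x0 hX dU cU Kb Kc)).
  + have : {ae P, forall w, forall i (t : R), 0 <= t ->
        sde_coef U (c i) t (Dx 1 U t x w) w = Dx 1 (c i) t x w}.
      by apply: filter_forall => i; exact: coefE.
    by apply: filterS => w E i t t0; rewrite ZE E.
  + apply: filterS2 U0 (coefE b x x0) => w U0w E t t0; rewrite ZE.
    congr (_ - _ - _).
      rewrite /Dx/= -uxz; apply: eq_pos_derive1 => // y y0; by rewrite U0w// u0u.
    apply: eq_Rintegral => s /set_mem/=; rewrite in_itv/= => /andP[s0 _].
    by rewrite ZE E.
Qed.

End utility_field.
End necessary_condition.

(** * Joint continuity *)

Section joint_continuity.
Context {R : realType}.
Implicit Types (z : R -> R -> R).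

Lemma times_positives (t x : R) : (times `*` positives) (t, x) <-> 0 <= t /\ 0 < x.
Proof. by rewrite /times /positives; split => -[]; rewrite /= !in_itv/= !andbT. Qed.

Lemma positives_gt0 (x : R) : positives x <-> 0 < x.
Proof. by rewrite /positives/= in_itv/= andbT. Qed.

Lemma joint_continuity_dist z :
  {within times `*` positives, continuous (fun p : R * R => z p.1 p.2)} <->
  (forall t x : R, 0 <= t -> 0 < x -> forall e : R, 0 < e -> exists2 r : R, 0 < r &
    forall s y : R, 0 <= s -> 0 < y -> `|t - s| < r -> `|x - y| < r -> `|z t x - z s y| < e).
Proof.
split.
- move=> /within_continuous_dist H t x t0 x0 e e0.
  have [r r0 rP] := H (t, x) ((times_positives t x).2 (conj t0 x0)) e e0.
  exists r => // s y s0 y0 ts xy.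
  exact: rP (s, y) ((times_positives s y).2 (conj s0 y0)) (conj ts xy).
- move=> H; apply/within_continuous_dist => -[t x] /times_positives[t0 x0] e e0.
  have [r r0 rP] := H t x t0 x0 e e0; exists r => // -[s y] /times_positives[s0 y0] [ts xy].
  exact: rP.
Qed.

Lemma joint_continuity_x z (t x : R) :
  {within times `*` positives, continuous (fun p : R * R => z p.1 p.2)} ->
  0 <= t -> 0 < x -> {for x, continuous (z t)}.
Proof.
move=> /joint_continuity_dist cz t0 x0; apply/cvgrPdist_lt => e e0.
have [r r0 rP] := cz t x t0 x0 e e0; near=> y.
have y0 : 0 < y by near: y; exact: near_positive.
have xy : ball x r y by near: y; apply/nbhs_ballP; exists r.
by apply: rP => //; rewrite subrr normr0.
Unshelve. all: by end_near. Qed.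

Lemma joint_continuity_t z (x : R) :
  {within times `*` positives, continuous (fun p : R * R => z p.1 p.2)} ->
  0 < x -> {within times, continuous (z ^~ x)}.
Proof.
move=> /joint_continuity_dist cz x0; apply/within_continuous_dist => t.
rewrite {1}/times/= in_itv/= andbT => t0 e e0.
have [r r0 rP] := cz t x t0 x0 e e0; exists r => // s.
rewrite /times/= in_itv/= andbT => s0 ts; apply: rP => //.
by rewrite subrr normr0.
Qed.

(** The values at two rational points on either side of [x] enclose those at the
    points in between, and move little with [t]. *)
Lemma monotone_joint_continuity z :
  (forall t x y : R, 0 <= t -> 0 < x -> x <= y -> z t x <= z t y) ->
  (forall t x : R, 0 <= t -> 0 < x -> {for x, continuous (z t)}) ->
  (forall k, 0 < rat_seq k :> R -> {within times, continuous (z ^~ (rat_seq k))}) ->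
  {within times `*` positives, continuous (fun p : R * R => z p.1 p.2)}.
Proof.
move=> zm zx zt; apply/joint_continuity_dist => t x t0 x0 e e0.
have e2 : 0 < e / 2 by lra.
have /cvgrPdist_lt/(_ _ e2)/nbhs_ballP[r /= r0 rP] := zx t x t0 x0.
have [j /andP[j1 j2]] : exists k, Num.max 0 (x - r) < rat_seq k < x.
  by apply: rat_seq_dense; rewrite gt_max; lra.
have [k /andP[k1 k2]] : exists k, x < rat_seq k < x + r.
  by apply: rat_seq_dense; lra.
move: j1; rewrite gt_max => /andP[j0 j1].
have k0 : 0 < rat_seq k :> R by lra.
have hj := rP (rat_seq j) ltac:(rewrite /ball/= ltr_norml; lra).
have hk := rP (rat_seq k) ltac:(rewrite /ball/= ltr_norml; lra).
have tt : times t by rewrite /times/= in_itv/= t0.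
have /within_continuous_dist/(_ t tt _ e2)[a a0 aP] := zt j j0.
have /within_continuous_dist/(_ t tt _ e2)[b b0 bP] := zt k k0.
pose dl := Num.min (Num.min a b) (Num.min (x - rat_seq j) (rat_seq k - x)).
exists dl => [|s y s0 y0]; first by rewrite /dl !lt_min a0 b0; lra.
have ss : times s by rewrite /times/= in_itv/= s0.
rewrite /dl !lt_min => /andP[/andP[sa sb] _] /andP[_ /andP[yj yk]].
have {}aP := aP s ss sa; have {}bP := bP s ss sb.
have jy : rat_seq j < y by move: yj; rewrite ltr_norml; lra.
have yk' : y < rat_seq k by move: yk; rewrite ltr_norml; lra.
have m1 := zm s _ _ s0 j0 (ltW jy); have m2 := zm s _ _ s0 y0 (ltW yk').
by move: hj hk aP bP; rewrite /ball/= !ltr_norml; lra.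
Qed.

End joint_continuity.

(** * Primitives of decreasing positive fields *)

Section concavity.
Context {R : realType}.

(** The mean value theorem on both sides of the intermediate point. *)
Lemma strictly_concave_of_derive1 (f : R -> R) :
  (forall x : R, 0 < x -> derivable f x 1) ->
  (forall x y : R, 0 < x -> x < y -> derive1 f y < derive1 f x) ->
  strictly_concave f.
Proof.
move=> df f'd.
have H x y l : 0 < x -> x < y -> 0 < l < 1 ->
    l * f x + (1 - l) * f y < f (l * x + (1 - l) * y).
  move=> x0 xy /andP[l0 l1]; set m := l * x + (1 - l) * y.
  have xm : x < m by rewrite /m; nra.
  have my : m < y by rewrite /m; nra.
  have [c1 /andP[c1x c1m] E1] := MVT_pos x0 xm df.
  have [c2 /andP[c2m c2y] E2] := MVT_pos (lt_trans x0 xm) my df.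
  have c10 := lt_trans x0 c1x.
  have c12 := f'd c1 c2 c10 (lt_trans c1m c2m).
  have h1 : m - x = (1 - l) * (y - x) by rewrite /m; ring.
  have h2 : y - m = l * (y - x) by rewrite /m; ring.
  rewrite h1 in E1; rewrite h2 in E2.
  rewrite -subr_gt0 (_ : _ - _ = l * (1 - l) * (y - x) * (derive1 f c1 - derive1 f c2)).
    by rewrite !mulr_gt0// subr_gt0.
  have -> : f x = f m - derive1 f c1 * ((1 - l) * (y - x)) by rewrite -E1; ring.
  have -> : f y = f m + derive1 f c2 * (l * (y - x)) by rewrite -E2; ring.
  ring.
move=> x y l x0 y0 xy l01; case: (ltgtP x y) xy => // xy _; first exact: H.
have l01' : 0 < 1 - l < 1 by lra.
have -> : l * x + (1 - l) * y = (1 - l) * y + (1 - (1 - l)) * x by ring.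
by have := H y x (1 - l) y0 xy l01'; lra.
Qed.

End concavity.

Section primitives.
Context {R : realType}.
Notation leb := (@lebesgue_measure R).
Variable f : R -> R -> R.
Hypothesis f_gt0 : forall t x : R, 0 <= t -> 0 < x -> 0 < f t x.
Hypothesis f_decr : forall t x y : R, 0 <= t -> 0 < x -> x < y -> f t y < f t x.
Hypothesis f_cont :
  {within times `*` positives, continuous (fun p : R * R => f p.1 p.2)}.
Hypothesis f_int : forall T : R, 0 < T -> exists2 e : R, 0 < e &
  (\int[leb]_(x in `]0%R, e[) ereal_sup [set `|f t x|%:E | t in `[0%R, T]] < +oo)%E.

Let U (t x : R) : R := \int[leb]_(y in `]0, x[) f t y.

Let f_cont_x t x : 0 <= t -> 0 < x -> {for x, continuous (f t)}.
Proof. exact: joint_continuity_x. Qed.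

Let mitv (a b : R) : measurable (`]a, b[%classic : set R).
Proof. exact: measurable_itv. Qed.

Let f_meas t (X : R) : 0 <= t -> measurable_fun `]0, X[ (f t).
Proof.
move=> t0; apply: open_continuous_measurable_fun; first exact: interval_open.
by move=> x /set_mem/=; rewrite in_itv/= => /andP[x0 _]; exact: f_cont_x.
Qed.

(** [f] decreases in space, so that its values at [x] bound it on [[x, +oo[]. *)
Let f_bounded (T x : R) : 0 <= T -> 0 < x -> exists C : R,
  forall t y, 0 <= t <= T -> x <= y -> f t y <= C.
Proof.
move=> T0 x0.
have cf : {within `[0, T], continuous (f ^~ x)}.
  apply: (@continuous_subspaceW _ _ _ times).
    by move=> s /=; rewrite /times/= !in_itv/= => /andP[-> _].
  exact: joint_continuity_t f_cont x0.
have [c _ cP] := EVT_max T0 cf; exists (f c x) => t y tT.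
rewrite le_eqVlt => /predU1P[<-|xy]; first by apply: cP; rewrite in_itv.
have t0 : 0 <= t by case/andP: tT.
by apply: (le_trans (ltW (f_decr t0 x0 xy))); apply: cP; rewrite in_itv.
Qed.

(** Integrability of the running maximum near [0], together with the bound of a
    decreasing function away from [0], dominates [f] on [[0, T]]. *)
Let f_dominated (T X : R) : 0 < T -> exists2 g : R -> R,
  leb.-integrable `]0, X[ (EFin \o g) &
  forall t x, 0 <= t <= T -> 0 < x -> `|f t x| <= g x.
Proof.
move=> T0; have [e e0 intS] := f_int T0.
have mh t : 0 <= t <= T -> measurable_fun `]0, e[ (fun x => `|f t x|).
  by move=> /andP[t0 _]; apply: measurableT_comp => //; exact: f_meas.
have ch x : `]0, e[%classic x -> {within `[0, T], continuous (fun t => `|f t x|)}.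
  rewrite /= in_itv/= => /andP[x0 _]; apply: (@continuous_subspaceW _ _ _ times).
    by move=> s /=; rewrite /times/= !in_itv/= => /andP[-> _].
  by move=> t; apply: cvg_norm; exact: (joint_continuity_t f_cont x0).
have [D iD DP] := integrable_sup_bound (h := fun x t => `|f t x|) (mitv 0 e) (ltW T0)
  (fun _ _ => normr_ge0 _) mh ch intS.
have [C CP] := f_bounded (ltW T0) e0.
have C0 : 0 < C by apply: lt_le_trans (CP 0 e _ _); rewrite ?f_gt0// lexx (ltW T0).
exists (fun x => (D \_ `]0, e[) x + C).
  have i1 : leb.-integrable `]0, X[ (EFin \o (D \_ `]0, e[)).
    rewrite -restrict_EFin; apply/(@integrable_restrict _ _ _ leb _ (mitv 0 e) _ (mitv 0 X)).
    apply: (@integrableS _ _ _ leb _ _ _ (mitv 0 e) _ _ iD); last by move=> x [].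
    by apply: measurableI; exact: mitv.
  have i2 : leb.-integrable `]0, X[ (EFin \o (fun _ : R => C)).
    apply/integrableP; split; first by apply/measurable_EFinP; exact: measurable_cst.
    rewrite integral_cst//= lte_mul_pinfty ?lee_fin ?normr_ge0//.
    by rewrite lebesgue_measure_itv/=; case: ifP => _; rewrite ?ltry// -EFinB ltry.
  have := @integrableD _ _ _ leb _ (mitv 0 X) _ _ i1 i2.
  by apply: eq_integrable => // x _ /=; rewrite EFinD.
move=> t x tT x0; rewrite /patch; have t0 : 0 <= t by case/andP: tT.
have [xe|xe] := boolP (x \in `]0, e[%classic).
  by rewrite (le_trans (DP x t (set_mem xe) tT))// lerDl ltW.
rewrite add0r ger0_norm; last exact/ltW/f_gt0.
apply: CP => //.
rewrite leNgt; apply: contra xe => xe; rewrite mem_set//=.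
by rewrite in_itv/= x0.
Qed.

Lemma primitive_integrable t (X : R) : 0 <= t -> leb.-integrable `]0, X[ (EFin \o f t).
Proof.
move=> t0; have t1 : 0 < t + 1 by lra.
have [g ig gP] := @f_dominated (t + 1) X t1.
apply: (@le_integrable _ _ _ leb _ (mitv 0 X) _ (EFin \o g)) => //.
  by apply/measurable_EFinP; exact: f_meas.
move=> x /=; rewrite in_itv/= => /andP[x0 _]; rewrite lee_fin.
by apply: le_trans (ler_norm _); apply: gP => //; lra.
Qed.

(** The fundamental theorem of calculus on [[0, x + 1]]. *)
Lemma primitive_derive t (x : R) : 0 <= t -> 0 < x ->
  derivable (U t) x 1 /\ derive1 (U t) x = f t x.
Proof.
move=> t0 x0.
have UE : U t = (fun y => \int[leb]_(s in [set` Interval (BRight 0) (BRight y)]) f t s).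
  by apply/funext => y; apply: Rintegral_itv_bndo_bndc; exact: primitive_integrable.
rewrite UE; have xx : x < x + 1 by lra.
apply: (@continuous_FTC1 _ _ (BRight 0) x (x + 1) xx) => //; last exact: f_cont_x.
apply: (@integrableS _ _ _ leb _ _ _ (mitv 0 (x + 2)) _ _ (primitive_integrable _ t0)).
  exact: measurable_itv.
by apply: subset_itvl; rewrite bnd_simp; lra.
Qed.

Lemma primitive_ge0 t (x : R) : 0 <= t -> 0 <= U t x.
Proof.
move=> t0; apply: Rintegral_ge0 => y /=; rewrite in_itv/= => /andP[y0 _].
exact/ltW/f_gt0.
Qed.

Lemma primitive_vanish t : 0 <= t -> U t x @[x --> 0^'+] --> 0.
Proof.
move=> t0; pose g := f t \_ `]0, 1[.
have m01 : measurable (`[0, 1]%classic : set R) by exact: measurable_itv.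
have ig : leb.-integrable `[0, 1] (EFin \o g).
  rewrite /g -restrict_EFin; apply/(@integrable_restrict _ _ _ leb _ (mitv 0 1) _ m01).
  rewrite (_ : _ `&` _ = `]0, 1[%classic); first exact: primitive_integrable.
  by apply: setIidr; exact: subset_itv_oo_cc.
have c : parameterized_integral leb 0 x g @[x --> 0^'+] --> 0.
  by apply: cvg_at_right_filter; exact: parameterized_integral_cvg_left ltr01 ig.
apply: cvg_trans c; apply: near_eq_cvg; near=> x.
have x0 : 0 < x by near: x; exact: nbhs_right_gt.
have x1 : x < 1 by near: x; exact: nbhs_right_lt.
rewrite /parameterized_integral /g -Rintegral_mkcondr (_ : _ `&` _ = `]0, x]%classic).
  by symmetry; apply: Rintegral_itv_bndo_bndc; exact: primitive_integrable.
apply/seteqP; split => y /=; rewrite !in_itv/=; lra.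
Unshelve. all: by end_near. Qed.

(** The integrand is extended to negative times by reflection, which turns
    continuity at time 0 into continuity at an interior point. *)
Let primitive_continuous_t t0 (x : R) : 0 <= t0 -> 0 < x -> forall e, 0 < e ->
  exists2 r : R, 0 < r & forall s, 0 <= s -> `|t0 - s| < r -> `|U t0 x - U s x| < e.
Proof.
move=> t00 x0 e e0; have t1 : 0 < t0 + 1 by lra.
have [g ig gP] := @f_dominated (t0 + 1) x t1.
have I s : `]t0 - 1, t0 + 1[%classic s -> 0 <= `|s| <= t0 + 1.
  by rewrite /= in_itv/= => /andP[h1 h2]; rewrite normr_ge0 ler_norml; lra.
have c : {in `]t0 - 1, t0 + 1[%classic,
    continuous (fun s => \int[leb]_(y in `]0, x[) f `|s| y)}.
  apply: (@continuity_under_integral R _ _ leb (fun s y => f `|s| y) _ (mitv 0 x)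
      _ _ _ _ g ig).
  - by move=> s sI; exact: primitive_integrable.
  - apply: aeW => y /=; rewrite in_itv/= => /andP[y0 _] s _.
    apply/cvgrPdist_lt => e' e'0.
    have [r r0 rP] := (joint_continuity_dist f).1 f_cont `|s| y (normr_ge0 _) y0 e' e'0.
    apply/nbhs_ballP; exists r => // v sv /=; apply: rP => //.
      exact: le_lt_trans (ler_dist_dist _ _) sv.
    by rewrite subrr normr0.
  - move=> s sI; apply: aeW => y /=; rewrite in_itv/= => /andP[y0 _].
    by apply: gP => //; exact: I.
have tI : t0 \in `]t0 - 1, t0 + 1[%classic by rewrite mem_set//= in_itv/=; lra.
have /cvgrPdist_lt/(_ e e0)/nbhs_ballP[r /= r0 rP] := c t0 tI.
exists r => // s s0 ts; have := rP s ts.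
by rewrite /= (ger0_norm t00) (ger0_norm s0).
Qed.

(** Continuity in time at the given [x], and a Lipschitz bound in space that is
    uniform over the times of a compact interval. *)
Lemma primitive_joint_continuous :
  {within times `*` positives, continuous (fun p : R * R => U p.1 p.2)}.
Proof.
apply/joint_continuity_dist => t x t0 x0 e e0; have e2 : 0 < e / 2 by lra.
have [r1 r10 r1P] := primitive_continuous_t t0 x0 e2.
have x2 : 0 < x / 2 by lra.
have T0 : 0 <= t + 1 by lra.
have [C CP] := f_bounded T0 x2.
have C0 : 0 < C.
  by apply: lt_le_trans (CP 0 (x / 2) _ _); rewrite ?f_gt0// lexx.
have lip s y y' : 0 <= s <= t + 1 -> x / 2 <= y -> y < y' -> `|U s y - U s y'| <= C * (y' - y).
  move=> sT xy yy; have s0 : 0 <= s by case/andP: sT.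
  have y0 : 0 < y by lra.
  have [z|c /andP[yc _] E] := MVT_pos y0 yy (f := U s).
    by move=> z0; case: (primitive_derive s0 z0).
  have c0 := lt_trans y0 yc.
  rewrite distrC E (primitive_derive s0 c0).2 normrM gtr0_norm ?f_gt0//.
  rewrite gtr0_norm ?subr_gt0// ler_wpM2r//; first by rewrite subr_ge0 ltW.
  by apply: CP => //; lra.
exists (Num.min (Num.min r1 1) (Num.min (x / 2) (e / 2 / C))).
  by rewrite !lt_min r10 ltr01 x2 divr_gt0.
move=> s y s0 y0; rewrite !lt_min => /andP[/andP[ts1 ts2] _] /andP[_ /andP[xy1 xy2]].
have sT : 0 <= s <= t + 1 by move: ts2; rewrite ltr_norml s0/=; lra.
have h1 := r1P s s0 ts1.
have h2 : `|U s x - U s y| <= C * `|x - y|.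
  case: (ltgtP x y) => [xy|xy|->].
  - by rewrite distrC [X in C * X]distrC (gtr0_norm (_ : 0 < y - x)) ?subr_gt0// distrC lip//; lra.
  - rewrite distrC (gtr0_norm (_ : 0 < x - y)) ?subr_gt0// lip//.
    by move: xy1; rewrite ltr_norml; lra.
  - by rewrite !subrr !normr0 mulr0.
have h3 : C * `|x - y| < e / 2 by rewrite mulrC -ltr_pdivlMr.
rewrite (splitr e) (le_lt_trans (ler_distD (U s x) _ _))// ltrD//.
exact: le_lt_trans h3.
Qed.

Lemma primitive_concave t : 0 <= t -> strictly_concave (U t).
Proof.
move=> t0; apply: strictly_concave_of_derive1 => [x x0|x y x0 xy].
  by case: (primitive_derive t0 x0).
have y0 := lt_trans x0 xy.
by rewrite (primitive_derive t0 x0).2 (primitive_derive t0 y0).2 f_decr.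
Qed.

Lemma primitive_increasing t : 0 <= t -> strictly_increasing (U t).
Proof.
move=> t0 x y; rewrite !in_itv/= !andbT => x0 y0 xy.
have dU z : 0 < z -> derivable (U t) z 1 by move=> /(primitive_derive t0)[].
have [c /andP[xc _] E] := MVT_pos x0 xy dU.
have c0 := lt_trans x0 xc.
by rewrite -subr_gt0 E (primitive_derive t0 c0).2 mulr_gt0 ?f_gt0// subr_gt0.
Qed.

End primitives.

(** * The primitive of a flow along a path *)

Section primitive_utility.
Context {R : realType}.
Notation leb := (@lebesgue_measure R).

Lemma joint_continuity_eq (f g : R -> R -> R) :
  (forall t x : R, 0 <= t -> 0 < x -> f t x = g t x) ->
  {within times `*` positives, continuous (fun p : R * R => f p.1 p.2)} ->
  {within times `*` positives, continuous (fun p : R * R => g p.1 p.2)}.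
Proof.
move=> fg /joint_continuity_dist cf; apply/joint_continuity_dist => t x t0 x0 e e0.
have [r r0 rP] := cf t x t0 x0 e e0; exists r => // s y s0 y0 ts xy.
by rewrite -!fg//; exact: rP.
Qed.

Lemma joint_continuity_comp (f : R -> R -> R) (v : R -> R) :
  (forall x, 0 < x -> 0 < v x) -> (forall x, 0 < x -> {for x, continuous v}) ->
  {within times `*` positives, continuous (fun p : R * R => f p.1 p.2)} ->
  {within times `*` positives, continuous (fun p : R * R => f p.1 (v p.2))}.
Proof.
move=> v0 cv /joint_continuity_dist cf.
apply/(joint_continuity_dist (fun t x => f t (v x))) => t x t0 x0 e e0.
have [r r0 rP] := cf t (v x) t0 (v0 x x0) e e0.
have /cvgrPdist_lt/(_ r r0)/nbhs_ballP[q /= q0 qP] := cv x x0.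
exists (Num.min r q) => [|s y s0 y0]; first by rewrite lt_min r0.
rewrite !lt_min => /andP[ts _] /andP[_ xy]; apply: rP => //; first exact: v0.
exact: qP.
Qed.

Lemma joint_continuity_snd (g : R -> R) :
  (forall x, 0 < x -> {for x, continuous g}) ->
  {within times `*` positives, continuous (fun p : R * R => g p.2)}.
Proof.
move=> cg; apply/(joint_continuity_dist (fun _ x => g x)) => t x t0 x0 e e0.
have /cvgrPdist_lt/(_ e e0)/nbhs_ballP[q /= q0 qP] := cg x x0.
by exists q => // s y _ _ _ xy; exact: qP.
Qed.

Variables (u : R -> R) (z : R -> R -> R).
Hypothesis hu : utility_function u.
Hypothesis z_incr : forall t : R, 0 <= t -> strictly_increasing (z t).
Hypothesis z_derivable : forall t x : R, 0 <= t -> 0 < x -> derivable (z t) x 1.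
Hypothesis dz_cont :
  {within times `*` positives, continuous (fun p : R * R => derive1 (z p.1) p.2)}.
Hypothesis z_range : forall t : R, 0 <= t -> [set z t x | x in positives] = positives.
Hypothesis z_cont_t : forall k, 0 < rat_seq k :> R ->
  {within times, continuous (z ^~ (rat_seq k))}.
Hypothesis z_int : forall T : R, 0 < T -> exists2 e : R, 0 < e &
  (\int[leb]_(x in `]0%R, e[)
     ereal_sup [set `|z t (derive1 u x)|%:E | t in `[0%R, T]] < +oo)%E.

Let f (t x : R) : R := z t (derive1 u x).
Let U (t x : R) : R := \int[leb]_(y in `]0, x[) f t y.

Let z_lt (t x y : R) : 0 <= t -> 0 < x -> x < y -> z t x < z t y.
Proof.
move=> t0 x0 xy; apply: z_incr => //; rewrite in_itv/= andbT//.
exact: lt_trans xy.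
Qed.

Let z_gt0 (t x : R) : 0 <= t -> 0 < x -> 0 < z t x.
Proof.
move=> t0 x0; apply/positives_gt0; rewrite -(z_range t0).
by exists x => //; exact/positives_gt0.
Qed.

Let z_surj (t y : R) : 0 <= t -> 0 < y -> exists2 x, 0 < x & z t x = y.
Proof.
move=> t0 /positives_gt0; rewrite -(z_range t0) => -[x /positives_gt0 x0 <-].
by exists x.
Qed.

Let z_cont : {within times `*` positives, continuous (fun p : R * R => z p.1 p.2)}.
Proof.
apply: monotone_joint_continuity => // t x.
- move=> y t0 x0; rewrite le_eqVlt => /predU1P[->//|xy]; exact/ltW/z_lt.
- by move=> t0 x0; exact/derivable_continuous/z_derivable.
Qed.

Let f_gt0 (t x : R) : 0 <= t -> 0 < x -> 0 < f t x.
Proof. by move=> t0 x0; apply: z_gt0 => //; exact: utility_derive1_gt0. Qed.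

Let f_decr (t x y : R) : 0 <= t -> 0 < x -> x < y -> f t y < f t x.
Proof.
move=> t0 x0 xy; apply: z_lt => //; last exact: utility_derive1_lt.
by apply: utility_derive1_gt0 => //; exact: lt_trans xy.
Qed.

Let f_cont : {within times `*` positives, continuous (fun p : R * R => f p.1 p.2)}.
Proof.
apply: (@joint_continuity_comp z (derive1 u)) => //.
- exact: utility_derive1_gt0.
- exact: utility_derive1_continuous.
Qed.

Let dU (t x : R) : 0 <= t -> 0 < x -> derivable (U t) x 1.
Proof. by move=> t0 x0; case: (primitive_derive f_gt0 f_decr f_cont z_int t0 x0). Qed.

Let dUE (t x : R) : 0 <= t -> 0 < x -> derive1 (U t) x = f t x.
Proof. by move=> t0 x0; case: (primitive_derive f_gt0 f_decr f_cont z_int t0 x0). Qed.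

Let df (t x : R) : 0 <= t -> 0 < x -> derivable (f t) x 1.
Proof.
move=> t0 x0; apply/derivable1_diffP.
apply: (@differentiable_comp _ _ _ _ (derive1 u) (z t)).
- by apply/derivable1_diffP; exact: utility_derivable2.
- by apply/derivable1_diffP; apply: z_derivable => //; exact: utility_derive1_gt0.
Qed.

Let d2UE (t x : R) : 0 <= t -> 0 < x ->
  derive1n 2 (U t) x = derive1 (z t) (derive1 u x) * derive1n 2 u x.
Proof.
move=> t0 x0; rewrite -[LHS]/(derive1 (derive1 (U t)) x).
rewrite (@eq_pos_derive1 _ _ (f t))//; last by move=> y y0; exact: dUE.
apply: (@derive1_comp _ (derive1 u) (z t)); first exact: utility_derivable2.
by apply: z_derivable => //; exact: utility_derive1_gt0.
Qed.

(** With [f(t, x) = z(t, u'(x))] one has [U_x = f] and, by the chain rule,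
    [U_xx(t, x) = z_x(t, u'(x)) u''(x)]. *)
Lemma primitive_Cn_continuous j : (j <= 2)%N ->
  {within times `*` positives, continuous (fun p : R * R => derive1n j (U p.1) p.2)}.
Proof.
case: j => [|[|[|//]]] _.
- exact: (primitive_joint_continuous f_gt0 f_decr f_cont z_int).
- apply: (@joint_continuity_eq f (fun t => derive1 (U t))) => //.
  by move=> t x t0 x0; rewrite dUE.
- apply: (@joint_continuity_eq
    (fun t x => derive1 (z t) (derive1 u x) * derive1n 2 u x)
    (fun t => derive1n 2 (U t))).
    by move=> t x t0 x0; rewrite d2UE.
  have c1 : {within times `*` positives,
      continuous (fun p : R * R => derive1 (z p.1) (derive1 u p.2))}.
    apply: (@joint_continuity_comp (fun t => derive1 (z t)) (derive1 u)) => //.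
    + exact: utility_derive1_gt0.
    + exact: utility_derive1_continuous.
  have c2 : {within times `*` positives, continuous (fun p : R * R => derive1n 2 u p.2)}.
    by apply: joint_continuity_snd; case: (utility_C2 hu).
  by move=> p; apply: cvgM; [exact: c1|exact: c2].
Qed.

Lemma primitive_utility (t : R) : 0 <= t -> utility_function (U t).
Proof.
move=> t0; split.
- by move=> x x0; exact: primitive_ge0.
- exact: (primitive_increasing f_gt0 f_decr f_cont z_int).
- exact: (primitive_concave f_gt0 f_decr f_cont z_int).
- split=> [[|[|//]] _ x x0|x x0].
  + exact: dU.
  + exact: (eq_pos_derivable (fun y y0 => esym (dUE t0 y0)) x0 (df t0 x0)).
  + exact: (@joint_continuity_x _ (fun t => derive1n 2 (U t)) t x (@primitive_Cn_continuous 2 isT) t0 x0).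
- exact: (primitive_vanish f_gt0 f_decr f_cont z_int).
- apply/cvgryPgt => A.
  have [y y0 yA] : exists2 y, 0 < y & z t y = Num.max 0 A + 1.
    by apply: z_surj => //; rewrite ltr_wpDl// le_max lexx.
  near=> x; have x0 : 0 < x by near: x; exact: nbhs_right_gt.
  have yx : y < derive1 u x.
    by near: x; have /cvgryPgt := utility_inada_d0 hu; exact.
  rewrite dUE//; apply: (@lt_trans _ _ (z t y)); last exact: z_lt.
  by rewrite yA (@le_lt_trans _ _ (Num.max 0 A)) ?ltrDl// le_max lexx orbT.
- apply/cvgrPdist_lt => e e0; have [y y0 yA] := z_surj t0 e0.
  near=> x; have x0 : 0 < x by near: x; apply: nbhs_pinfty_gt; exact: num_real.
  have : `|0 - derive1 u x| < y.
    by near: x; have /cvgrPdist_lt := utility_inada_doo hu; exact.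
  rewrite !sub0r !normrN dUE// [X in _ -> X < _]gtr0_norm ?f_gt0// => /ltr_normlW xy.
  by rewrite -yA; apply: z_lt => //; exact: utility_derive1_gt0.
Unshelve. all: by end_near. Qed.

End primitive_utility.

(** * Measurability of the primitive *)

Section measurable_primitive.
Context {R : realType}.
Notation leb := (@lebesgue_measure R).

(** Tonelli's theorem for the positive and negative parts. *)
Lemma measurable_Rintegral_param {d} {S : measurableType d} (D : set R) (E : set S)
    (h : R -> S -> R) : measurable D -> measurable E ->
  measurable_fun (D `*` E) (fun q : R * S => h q.1 q.2) ->
  measurable_fun E (fun w => \int[leb]_(y in D) h y w).
Proof.
move=> mD mE mh.
pose g := (fun q : R * S => h q.1 q.2) \_ (setT `*` E).
have mg : measurable_fun (D `*` setT) g.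
  apply/(measurable_restrict _ _ _).1; [exact: measurableX|exact: measurableX|].
  by rewrite -setXI setIT setTI.
have mg' : measurable_fun (D `*` setT) (EFin \o g) by exact/measurable_EFinP.
have mA : measurable_fun setT (fun w => \int[leb]_(y in D) ((EFin \o g)^\+ (y, w)))%E.
  apply: (@measurable_integral_param _ _ _ D (fun y w => ((EFin \o g)^\+ (y, w))%E)) => //.
  rewrite (_ : (fun p : R * S => _) = (EFin \o g)^\+%E); last by apply/funext => -[].
  exact: measurable_funepos.
have mB : measurable_fun setT (fun w => \int[leb]_(y in D) ((EFin \o g)^\- (y, w)))%E.
  apply: (@measurable_integral_param _ _ _ D (fun y w => ((EFin \o g)^\- (y, w))%E)) => //.
  rewrite (_ : (fun p : R * S => _) = (EFin \o g)^\-%E); last by apply/funext => -[].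
  exact: measurable_funeneg.
have mAB := emeasurable_funB mA mB.
apply: (eq_measurable_fun (fun w => fine
  (\int[leb]_(y in D) ((EFin \o g)^\+ (y, w)) - \int[leb]_(y in D) ((EFin \o g)^\- (y, w)))%E)).
  move=> w wE; rewrite /Rintegral [in RHS]integralE; congr (fine (_ - _)%E).
  - apply: eq_integral => y _; rewrite !funeposE/= /g /patch/=.
    by rewrite in_setX in_setT wE.
  - apply: eq_integral => y _; rewrite !funenegE/= /g /patch/=.
    by rewrite in_setX in_setT wE.
apply: measurable_funTS.
by apply: measurableT_comp => //; exact: fine_measurable.
Qed.

(** The variable bound of the integral is moved into the integrand as an indicator,
    which leaves an integral over a fixed domain. *)
Lemma measurable_primitive {d} {S : measurableType d} (I : set R) (u : R -> R)
    (Z : R -> R -> S -> R) : measurable I -> utility_function u ->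
  measurable_fun (I `*` positives `*` setT) (fun p : R * R * S => Z p.1.1 p.1.2 p.2) ->
  measurable_fun (I `*` positives `*` setT)
    (fun p : R * R * S => primitive u Z p.1.1 p.1.2 p.2).
Proof.
move=> mI hu mZ.
have mpos : measurable (positives : set R) by exact: measurable_itv.
have mE : measurable (I `*` positives `*` setT : set (R * R * S)).
  by apply: measurableX => //; exact: measurableX.
pose h (y : R) (p : R * R * S) :=
  if y < p.1.2 then Z p.1.1 (derive1 u y) p.2 else 0.
apply: (eq_measurable_fun (fun p => \int[leb]_(y in positives) h y p)).
  move=> -[[t x] w] _ /=; rewrite /primitive/=.
  rewrite (_ : `]0, x[%classic = positives `&` `]-oo, x[%classic); last first.
    by apply/seteqP; split => y /=; rewrite /positives/= !in_itv/= andbT => /andP.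
  rewrite Rintegral_mkcondr; apply: eq_Rintegral => y _.
  by rewrite /h /patch/= mem_setE in_itv.
apply: measurable_Rintegral_param => //.
have mD : measurable (positives `*` (I `*` positives `*` setT) : set (R * (R * R * S))).
  exact: measurableX.
have op : open (positives : set R) by exact: interval_open.
have mu : measurable_fun positives (derive1 u).
  apply: (open_continuous_measurable_fun op).
  by move=> y /set_mem/positives_gt0 y0; exact: utility_derive1_continuous.
have mv := (measurable_restrictT (derive1 u) mpos).1 mu.
have mlt : measurable_fun (positives `*` (I `*` positives `*` setT))
    (fun q : R * (R * R * S) => q.1 < q.2.1.2).
  apply: measurable_funTS; apply: measurable_fun_ltr => //.
  exact: (measurableT_comp measurable_snd (measurableT_comp measurable_fst measurable_snd)).
apply: (measurable_fun_if (g := fun q : R * (R * R * S) => Z q.2.1.1 (derive1 u q.1) q.2.2)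
  (h := fun=> 0) mD mlt) => //.
apply: (@measurable_funS _ _ _ _ (positives `*` (I `*` positives `*` setT))) => //.
  apply: (@measurable_comp _ _ _ _ (R * R * S)%type _ (I `*` positives `*` setT)
    (fun p => Z p.1.1 p.1.2 p.2) _
    (fun q : R * (R * R * S) => (q.2.1.1, derive1 u q.1, q.2.2))) => //.
    move=> _ [[y [[t x] w]] [/positives_gt0 y0 [[It x0] _]] <-] /=.
    by split=> //; split=> //; apply/positives_gt0; exact: utility_derive1_gt0.
  apply: (eq_measurable_fun
    (fun q : R * (R * R * S) => (q.2.1.1, (derive1 u \_ positives) q.1, q.2.2))).
    move=> [y [[t x] w]] /set_mem[/= y0 _] /=.
    by rewrite /patch mem_set.
  apply: measurable_funTS; apply: measurable_fun_pair; last exact: measurableT_comp.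
  apply: measurable_fun_pair; last exact: measurableT_comp.
  by apply: measurableT_comp => //; exact: measurableT_comp.
Qed.

End measurable_primitive.

Section progressive_primitive.
Context {R : realType} {d : measure_display} {Omega : measurableType d}.
Variables (P : probability Omega R) (F : R -> set (set Omega)).
Hypothesis hF : usual_filtration P F.
Notation sigF t := (g_sigma_algebraType (F t)).
Variable Z : R -> R -> Omega -> R.
Hypothesis hZ : progressive_field F Z.
Hypothesis Z_incr : spatially P strictly_increasing Z.
Hypothesis Z_derivable : spatially P (fun f => forall z : R, 0 < z -> derivable f z 1) Z.

Let strip (t : R) : set (R * R * sigF t) := `[0, t] `*` positives `*` setT.

Let measurable_strip3 (t : R) : measurable (@strip t).
Proof. by do 2?[apply: measurableX => //]; exact: measurable_itv. Qed.

(** This presents the field as a countable supremum of progressive processes. *)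
Let ereal_sup_left (f : R -> R) (x : R) : strictly_increasing f -> 0 < x ->
  {for x, continuous f} ->
  (f x)%:E = esups (fun k => if 0 < (rat_seq k : R) < x then (f (rat_seq k))%:E else -oo%E) 0.
Proof.
move=> fi x0 /cvgrPdist_lt cf; apply/eqP; rewrite eq_le; apply/andP; split; last first.
  apply/ereal_supP => _ [k _ <-]; case: ifPn => [/andP[k0 kx]|_]; last exact: leNye.
  by rewrite lee_fin ltW//; apply: fi; rewrite ?in_itv/= ?k0 ?x0.
apply/lee_addgt0Pr => e e0; have /nbhs_ballP[r /= r0 rP] := cf e e0.
have [k /andP[k1 k2]] : exists k, Num.max 0 (x - r) < rat_seq k < x.
  by apply: rat_seq_dense; rewrite gt_max; lra.
move: k1; rewrite gt_max => /andP[k0 k1].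
have kx : ball x r (rat_seq k) by rewrite /ball/= ltr_norml; lra.
have := rP _ kx; rewrite /= ltr_norml => /andP[_ h].
apply: (@le_trans _ _ ((f (rat_seq k))%:E + e%:E)%E).
  by rewrite -EFinD lee_fin; lra.
by rewrite leeD2r//; apply: ereal_sup_ubound; exists k => //; rewrite k0 k2.
Qed.

(** Off a null set the field is determined by its values at rational points;
    on the null set every subset belongs to the filtration. *)
Lemma field_jointly_progressive (t : R) : 0 <= t ->
  measurable_fun (`[0, t] `*` positives `*` setT)
    (fun p : R * R * sigF t => Z p.1.1 p.1.2 p.2).
Proof.
move=> t0.
pose N := ~` [set w | forall s : R, 0 <= s -> strictly_increasing (fun x => Z s x w) /\
  forall x : R, 0 < x -> derivable (fun x => Z s x w) x 1].
have N0 : P.-negligible N.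
  by apply: filterS2 Z_incr Z_derivable => w h1 h2 s s0; split; [exact: h1|exact: h2].
have mN A : A `<=` N -> measurable (A : set (sigF t)).
  by move=> AN; apply: (negligible_measurable_filtration hF t0); exact: negligibleS N0.
have mstrip := @measurable_strip3 t.
have mbN : measurable_fun (@strip t) (fun p : R * R * sigF t => p.2 \in N).
  apply: measurable_funTS; apply: (measurable_fun_bool true).
  rewrite setTI (_ : _ @^-1` _ = snd @^-1` N); last by apply/seteqP; split => p /=; [exact: set_mem|exact: mem_set].
  rewrite -[X in measurable X]setTI.
  have ms := @measurable_snd _ _ (R * R)%type (sigF t).
  exact: (ms measurableT N (mN N (fun _ h => h))).
have H : measurable_fun (@strip t) (fun p : R * R * sigF t =>
    if p.2 \in N then Z p.1.1 p.1.2 p.2 else Z p.1.1 p.1.2 p.2).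
  apply: (measurable_fun_if mstrip mbN).
  (* On [N] the field factors through a map [phi] that is measurable because all
     subsets of [N] belong to the filtration. *)
  - pose phi (w : sigF t) : Omega := if w \in N then w else point.
    have mphi : measurable_fun setT phi.
      move=> _ A mA; rewrite setTI.
      rewrite (_ : _ @^-1` _ = (A `&` N) `|` ([set w | A point] `&` ~` N)).
        apply: (@measurableU _ (sigF t)); first by apply: mN => w [].
        apply: (@measurableI _ (sigF t)); last by apply: measurableC; exact: mN.
        have [Ap|Ap] := pselect (A point).
          by rewrite (_ : [set _ | _] = setT); [exact: measurableT|apply/seteqP; split].
        by rewrite (_ : [set _ | _] = set0); [exact: measurable0|apply/seteqP; split].
      apply/seteqP; split => w; rewrite /phi/=.
        by case: ifPn => [/set_mem|/negP wN Aw]; [left|right; split => // ?; apply: wN; rewrite inE].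
      by case: ifPn => [/set_mem wN|wN] [[]|[]]//; move=> _ wN'; rewrite notin_setE in wN.
    apply: (@eq_measurable_fun _ _ _ _ _ (fun p : R * R * sigF t => Z p.1.1 p.1.2 (phi p.2))).
      by move=> p /set_mem[_ /= pN]; rewrite /phi pN.
    apply: (@measurable_funS _ _ _ _ (@strip t)) => //.
    apply: (@measurable_comp _ _ _ _ (R * R * Omega)%type _ (times `*` positives `*` setT)
      (fun p => Z p.1.1 p.1.2 p.2) _ (fun p : R * R * sigF t => (p.1, phi p.2))).
    + by do 2?[apply: measurableX => //]; exact: measurable_itv.
    + move=> _ [[[s x] w] [[/= st x0] _] <-]; split=> //; split=> //.
      by move: st; rewrite /times/= !in_itv/= => /andP[->].
    + exact: field_measurable hZ.
    + apply: measurable_funTS; apply: measurable_fun_pair => //.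
      exact: (measurableT_comp mphi measurable_snd).
  - apply/measurable_EFinP.
    pose f k (p : R * R * sigF t) : \bar R :=
      if 0 < (rat_seq k : R) < p.1.2 then (Z p.1.1 (rat_seq k) p.2)%:E else -oo%E.
    apply: (@eq_measurable_fun _ _ _ _ _ (fun p => esups (f ^~ p) 0)).
      move=> [[s x] w] /set_mem[[[/= st x0] _] /negP/negP wN].
      have s0 : 0 <= s by move: st; rewrite /= in_itv/= => /andP[].
      move: wN; rewrite notin_setE/= /N/= => /contrapT/(_ s s0)[Zi Zd].
      have x0' := (positives_gt0 x).1 x0.
      by rewrite (ereal_sup_left Zi x0')//; exact/derivable_continuous/Zd.
    apply: (@measurable_funS _ _ _ _ (@strip t)) => //.
    apply: measurable_fun_esups => k; rewrite /f.
    have [k0|k0] := boolP (0 < (rat_seq k : R)); last exact: measurable_cst.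
    have mlt : measurable_fun (@strip t) (fun p : R * R * sigF t => rat_seq k < p.1.2).
      apply: measurable_funTS; apply: measurable_fun_ltr => //.
      exact: (measurableT_comp measurable_snd measurable_fst).
    apply: (measurable_fun_if (g := fun p : R * R * sigF t => (Z p.1.1 (rat_seq k) p.2)%:E)
      (h := fun=> -oo%E) mstrip mlt) => //.
    apply: (@measurable_funS _ _ _ _ (@strip t)) => //.
    apply/measurable_EFinP.
    apply: (@measurable_comp _ _ _ _ (R * sigF t)%type _ (`[0, t] `*` setT)
      (fun p => Z p.1 (rat_seq k) p.2) _ (fun p : R * R * sigF t => (p.1.1, p.2))).
    + exact: measurable_strip.
    + by move=> _ [[[s x] w] [[/= st x0] _] <-].
    + exact: (field_progressive hZ k0 t0).
    + apply: measurable_funTS; apply: measurable_fun_pair => //.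
      exact: (measurableT_comp measurable_fst measurable_fst).
by apply: eq_measurable_fun H => p _; case: ifP.
Qed.

Lemma progressive_field_primitive (u : R -> R) : utility_function u ->
  progressive_field F (primitive u Z).
Proof.
move=> hu; split.
  apply: measurable_primitive => //; first exact: measurable_itv.
  exact: field_measurable hZ.
move=> x x0 t t0.
have mI : measurable (`[0, t]%classic : set R) by exact: measurable_itv.
have := measurable_primitive (S := sigF t) (Z := Z) mI hu (field_jointly_progressive t0).
move=> mU.
apply: (@measurable_comp _ _ _ _ (R * R * sigF t)%type _ (@strip t)
  (fun p => primitive u Z p.1.1 p.1.2 p.2) _ (fun p : R * sigF t => (p.1, x, p.2))).
- exact: measurable_strip3.
- move=> _ [[s w] [/= st _] <-]; split=> //; split=> //; exact/positives_gt0.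
- exact: mU.
- apply: measurable_funTS; apply: measurable_fun_pair => //.
  by apply: measurable_fun_pair => //; exact: measurable_cst.
Qed.

End progressive_primitive.

(** * The two implications *)

Section characterization.
Context {R : realType} {d : measure_display} {Omega : measurableType d}.
Variables (P : probability Omega R) (F : R -> set (set Omega)).
Hypothesis hF : usual_filtration P F.
Variable Z : R -> R -> Omega -> R.
Hypothesis hZ : progressive_field F Z.
Hypothesis Z_cont : forall z : R, 0 < z -> as_continuous P (Z ^~ z).
Hypothesis Z_incr : spatially P strictly_increasing Z.
Hypothesis Z_derivable : spatially P (fun f => forall z : R, 0 < z -> derivable f z 1) Z.
Hypothesis dZ_cont : continuous_field P (Dx 1 Z).
Hypothesis Z_range : spatially P (fun f => [set f z | z in positives] = positives) Z.

(** The paths are treated one by one, by [primitive_utility]; off a null set,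
    continuity in time holds simultaneously at all positive rational points. *)
Lemma progressive_utility_primitive (u : R -> R) : utility_function u ->
  path_integrable_near0 P u Z -> progressive_utility P F (primitive u Z).
Proof.
move=> hu intZ.
have Zq : {ae P, forall w, forall k, 0 < rat_seq k :> R ->
    {within times, continuous ((Z ^~ (rat_seq k)) ^~ w)}}.
  apply: ae_foralln => k.
  have [k0|k0] := boolP (0 < (rat_seq k : R)); last exact: aeW.
  by apply: filterS (Z_cont k0).
split.
- exact: (progressive_field_primitive hF hZ Z_incr Z_derivable hu).
- apply: filterS2 (filterI (filterI Z_incr Z_derivable) (filterI dZ_cont Z_range))
    (filterI Zq intZ) => w [[h1 h2] [h3 h4]] [h5 h6] t t0.
  exact: (@primitive_utility _ u (fun t z => Z t z w) hu h1 (fun t x t0 => h2 t t0 x) h3 h4 h5 h6).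
- move=> j j2; apply: filterS2 (filterI (filterI Z_incr Z_derivable) (filterI dZ_cont Z_range))
    (filterI Zq intZ) => w [[h1 h2] [h3 h4]] [h5 h6].
  exact: (@primitive_Cn_continuous _ u (fun t z => Z t z w) hu h1 (fun t x t0 => h2 t t0 x)
    h3 h4 h5 h6 j j2).
Qed.

End characterization.

Unset Implicit Arguments.

Theorem theorem1p1 (R : realType) (d : measure_display)
    (Omega : measurableType d) (P : probability Omega R)
    (F : R -> set (set Omega)) (n : nat) (W : 'I_n -> R -> Omega -> R)
    (hF : usual_filtration P F) (hW : brownian P F W) :
  (forall (u : R -> R) (beta : R -> R -> Omega -> R)
      (gamma : 'I_n -> R -> R -> Omega -> R) (U : R -> R -> Omega -> R),
    ito_field P F W beta gamma U ->
    {ae P, forall w, forall x : R, 0 < x -> U 0 x w = u x} ->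
    progressive_utility P F U ->
    Kloc_semimartingale P 2 beta U ->
    Kloc P 1 (fun _ : 'I_1 => beta) ->
    Kbarloc P 1 gamma ->
    let Z (t z : R) w := Dx 1 U t (- derive1 (conjugate u) z) w in
    spatially P strictly_increasing Z /\
    sde_solution P F W (sde_coef U beta) (fun i => sde_coef U (gamma i)) Z) /\
  (forall (mu : R -> R -> Omega -> R) (sigma : 'I_n -> R -> R -> Omega -> R)
      (Z : R -> R -> Omega -> R),
    progressive_field F Z ->
    sde_solution P F W mu sigma Z ->
    spatially P strictly_increasing Z ->
    spatially P (fun f => forall z : R, 0 < z -> derivable f z 1) Z ->
    continuous_field P (Dx 1 Z) ->
    spatially P (fun f => [set f z | z in positives] = positives) Z ->
    forall u : R -> R, utility_function u -> path_integrable_near0 P u Z ->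
    progressive_utility P F (primitive u Z)).
Proof.
split.
  move=> u beta gamma U hX U0 hU _ Kb Kc /=; split.
    exact: (utility_marginal_increasing U0 hU).
  exact: (utility_marginal_sde hF hX U0 hU Kb Kc).
move=> mu sigma Z hZ hS incr der dcont range u hu intZ.
exact: (progressive_utility_primitive hF hZ (sde_continuous hS) incr der dcont range hu intZ).
Qed.
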